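(* Let $n\geq 1$ and let $A\subseteq \mathbb H^n$ be a Lebesgue measurable set of positive Korányi upper density, i.e. $$\limsup_{R\to\infty}\ \sup_{x\in\mathbb H^n}\frac{|A\cap B(x,R)|}{|B(x,R)|}>0.$$ Then there exists $R_0=R_0(A)>0$ such that for every $R\geq R_0$ there exist $x,y\in A$ with $d_K(x,y)=R$.
   Context: The Heisenberg group $\mathbb H^n$ ($n\ge 1$) is $\mathbb C^n\times\mathbb R$ with group law $(z,t)\cdot(w,s)=\big(z+w,\ t+s+\tfrac12\operatorname{Im}(z\cdot\overline w)\big)$, where $z\cdot\overline w=\sum_{j=1}^n z_j\overline{w_j}$; the inverse of $(z,t)$ is $(-z,-t)$. The Haar measure is Lebesgue measure $dz\,dt$ on $\mathbb R^{2n}\times\mathbb R$, and $|S|$ denotes the Haar measure of a set $S$. The Korányi norm is $|(z,t)|_K=(|z|^4+t^2)^{1/4}$, the Korányi distance is $d_K(x,y)=|y^{-1}\cdot x|_K$, and the Korányi ball is $B(a,r)=\{x\in\mathbb H^n: |a^{-1}\cdot x|_K<r\}$. *)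

(* Defs.v *)
From HB Require Import structures.
From mathcomp Require Import all_boot all_order all_algebra.
From mathcomp Require Import all_classical all_reals all_analysis.
Set Implicit Arguments. Unset Strict Implicit. Unset Printing Implicit Defensive.
Import Order.TTheory GRing.Theory Num.Theory.
Import numFieldTopology.Exports numFieldNormedType.Exports.
Local Open Scope classical_set_scope.
Local Open Scope ring_scope.

(* The Heisenberg group H^n = C^n x R.  A point (z, t) with
   z_j = x_j + i y_j is encoded as ((x, y), t) with x y : 'I_n -> R. *)
Definition heis (R : realType) (n : nat) : Type :=
  (('I_n -> R) * ('I_n -> R) * R)%type.

Section Heisenberg.
Variables (R : realType) (n : nat).
Local Notation H := (heis R n).

Definition hx (p : H) : 'I_n -> R := p.1.1.
Definition hy (p : H) : 'I_n -> R := p.1.2.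
Definition ht (p : H) : R := p.2.

(* Im (z . conj w) for z = x + i y, w = u + i v : sum_j (y_j u_j - x_j v_j) *)
Definition im_herm (p q : H) : R :=
  \sum_(j < n) (hy p j * hx q j - hx p j * hy q j).

Definition hmul (p q : H) : H :=
  ((fun j => hx p j + hx q j, fun j => hy p j + hy q j),
   ht p + ht q + 2^-1 * im_herm p q).

Definition hinv (p : H) : H :=
  ((fun j => - hx p j, fun j => - hy p j), - ht p).

Definition znorm2 (p : H) : R := \sum_(j < n) (hx p j ^+ 2 + hy p j ^+ 2).

Definition koranyi (p : H) : R := Num.sqrt (Num.sqrt (znorm2 p ^+ 2 + ht p ^+ 2)).

Definition dK (p q : H) : R := koranyi (hmul (hinv q) p).

Definition kball (a : H) (r : R) : set H := [set x | koranyi (hmul (hinv a) x) < r].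

Definition box_le (a b : H) : Prop :=
  (forall j, hx a j <= hx b j) /\ (forall j, hy a j <= hy b j) /\ ht a <= ht b.

Definition box (a b : H) : set H :=
  [set p | (forall j, hx a j <= hx p j < hx b j) /\
           (forall j, hy a j <= hy p j < hy b j) /\ ht a <= ht p < ht b].

Definition box_vol (a b : H) : R :=
  (\prod_(j < n) (hx b j - hx a j)) * (\prod_(j < n) (hy b j - hy a j)) * (ht b - ht a).

Definition box_covers (S : set H) : set ((nat -> H) * (nat -> H)) :=
  [set ab | (forall i, box_le (ab.1 i) (ab.2 i)) /\
            S `<=` \bigcup_i box (ab.1 i) (ab.2 i)].

Definition leb_outer (S : set H) : \bar R :=
  ereal_inf [set (\sum_(0 <= i <oo) (box_vol (ab.1 i) (ab.2 i))%:E)%E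
            | ab in box_covers S].

Definition leb_measurable (A : set H) : Prop :=
  forall E : set H, leb_outer E = (leb_outer (E `&` A) + leb_outer (E `&` ~` A))%E.

(* sup_x |A cap B(x,r)| / |B(x,r)|  (balls have finite measure) *)
Definition sup_density (A : set H) (r : R) : \bar R :=
  ereal_sup [set (fine (leb_outer (A `&` kball x r)) / fine (leb_outer (kball x r)))%:E
            | x in [set: H]].

Definition upper_density (A : set H) : \bar R :=
  limf_esup (sup_density A) (pinfty_nbhs R).

End Heisenberg.

(* Main.v *)
(** Right translation by the points [(a e_1, 0, b)] is an action of [R^2] on the Heisenberg
group preserving the measure, and a pair [(p, p * (a e_1, 0, b))] is at Korányi distance
[(a^4 + b^2)^(1/4)]. Let [A'] be the part of [A] in a huge ball in which [A] is dense.
The normalised correlation [F(a, b) = |A' ∩ A'(a, b)^-1| / |A'|] is positive definite,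
continuous in [b], has averages bounded below by the density, and vanishes on the curve
[a^4 + b^2 = r^4] for every [r] that is not a distance in [A].

Suppose there were such radii [r_1, ..., r_k] growing very fast. Given finitely many points
[u] of size much smaller than [r], one finds points [s_1, ..., s_N] of the curve of radius
[r] such that [F(s_m - u)] is small on average: since [F = 0] on the curve, by
Cauchy-Schwarz it suffices that the vectors [avg_m s_m] and [avg_m (s_m - u)] be close
for the form [F]; as the curve is strictly concave, this holds on average along a family of
translates of the configuration, by an integration by parts in the vertical variable.
Choosing such points successively at the scales [r_1, ..., r_k] gives [k] families that are
almost orthogonal for [F], which contradicts the lower bound on averages when [k] is
large compared with the inverse density. *)
Require Import Defs.
From HB Require Import structures.
From mathcomp Require Import all_boot all_order all_algebra.
From mathcomp Require Import all_classical all_reals all_analysis.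
From mathcomp Require Import measurable_realfun lebesgue_integral.
From mathcomp Require Import ring lra.
Import Order.TTheory GRing.Theory Num.Theory.
Import numFieldTopology.Exports numFieldNormedType.Exports.
Local Open Scope classical_set_scope.
Local Open Scope ring_scope.
Set Implicit Arguments. Unset Strict Implicit. Unset Printing Implicit Defensive.


(** * The outer measure *)

Section OuterMeasure.
Context {R : realType} {n : nat}.
Local Notation H := (heis R n).
Implicit Types (S T : set H) (a b p : H).

Lemma box_vol_ge0 a b : box_le a b -> 0 <= box_vol a b.
Proof.
move=> [hx1 [hy1 ht1]]; rewrite /box_vol.
by rewrite !mulr_ge0 ?subr_ge0 ?prodr_ge0 // => j _; rewrite subr_ge0.
Qed.

Lemma leb_outer_ge0 S : (0 <= leb_outer S)%E.
Proof.
apply: le_ereal_inf_tmp => _ [ab [hab _] <-].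
by apply: nneseries_ge0 => i _ _; rewrite lee_fin box_vol_ge0.
Qed.

Lemma leb_outer_cover S (a b : nat -> H) : (forall i, box_le (a i) (b i)) ->
  S `<=` \bigcup_i box (a i) (b i) ->
  (leb_outer S <= \sum_(0 <= i <oo) (box_vol (a i) (b i))%:E)%E.
Proof. by move=> hab hS; apply: ereal_inf_lbound; exists (a, b). Qed.

Lemma le_leb_outer S T : S `<=` T -> (leb_outer S <= leb_outer T)%E.
Proof.
move=> ST; apply: ereal_inf_le_tmp => _ [ab [hab hT] <-].
by exists ab => //; split => //; apply: subset_trans hT.
Qed.


Lemma box_vol_diag p : box_vol p p = 0.
Proof. by rewrite /box_vol subrr mulr0. Qed.

Lemma box_le_refl p : box_le p p.
Proof. by split=> //; split. Qed.

Lemma leb_outer_box_le a b : box_le a b -> (leb_outer (box a b) <= (box_vol a b)%:E)%E.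
Proof.
move=> hab.
(* The cover is the box itself followed by empty boxes from [b] to [b], of volume [0]. *)
have := @leb_outer_cover (box a b) (fun i => if i is 0%N then a else b)
   (fun=> b).
set u := (X in (_ <= X)%E); have -> : u = (box_vol a b)%:E.
  rewrite /u nneseries_recl//; last first.
    by case=> [|k] *; rewrite lee_fin; [exact: box_vol_ge0|rewrite box_vol_diag].
  rewrite eseries_cond/= eseries0 ?adde0// => -[|]//= k _ _.
  by rewrite box_vol_diag.
apply; first by case=> // *; exact: box_le_refl.
by move=> p hp; exists 0%N.
Qed.

Lemma leb_outer_set0 : leb_outer (set0 : set H) = 0%E.
Proof.
apply/eqP; rewrite eq_le leb_outer_ge0 andbT.
pose o : H := (fun=> 0, fun=> 0, 0).
have := leb_outer_box_le (box_le_refl o); rewrite box_vol_diag.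
by apply: le_trans; exact: le_leb_outer.
Qed.

(** Covers of [A k] optimal up to [e / 2 ^ k.+1] are merged into a single sequence along a bijection
    of [nat] with [nat * nat]; as the volumes are nonnegative, the merged series equals the iterated
    one. *)
Lemma leb_outer_sigma_subadditive : measure_extension.sigma_subadditive (@leb_outer R n).
Proof.
move=> A.
have [[i ioo]|] := pselect (exists i, leb_outer (A i) = +oo%E).
  rewrite (eseries_pinfty _ _ ioo) ?leey// => k _.
  by rewrite -ltNye (lt_le_trans _ (leb_outer_ge0 _)).
rewrite -forallNE => Aoo.
suff add2e (e : {posnum R}) :
    (leb_outer (\bigcup_k A k) <= \sum_(i <oo) leb_outer (A i) + e%:num%:E)%E.
  by apply/lee_addgt0Pr => _/posnumP[].
rewrite (le_trans _ (epsilon_trick _ _ _))//; last by move=> ?; exact: leb_outer_ge0.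
pose P k (ab : (nat -> H) * (nat -> H)) := box_covers (A k) ab /\
  (\sum_(j <oo) (box_vol (ab.1 j) (ab.2 j))%:E <= leb_outer (A k) + (e%:num / (2 ^ k.+1)%:R)%:E)%E.
have [G PG] : {G : nat -> (nat -> H) * (nat -> H) & forall k, P k (G k)}.
  apply: (@choice _ _ P) => k; rewrite /P.
  have fk : leb_outer (A k) \is a fin_num.
    rewrite ge0_fin_numE ?leb_outer_ge0// ltey; exact/eqP.
  have ek : (0 < e%:num / (2 ^ k.+1)%:R)%R by [].
  have [x [ab abA <-] xS] := lb_ereal_inf_adherent ek fk.
  by exists ab; split => //; exact/ltW.
pose v := uncurry (fun i j => (box_vol ((G i).1 j) ((G i).2 j))%:E : \bar R).
have v_ge0 x : (0 <= v x)%E.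
  by rewrite /v /uncurry; case: x => i j; rewrite lee_fin box_vol_ge0//; exact: (PG i).1.1.
apply: (@le_trans _ _ (\esum_(i in setT) v i)%E).
  have /card_esym/ppcard_eqP[f] := card_nat2.
  have -> : (\esum_(i in setT) v i =
      \sum_(0 <= k <oo) (box_vol ((G (f k).1).1 (f k).2) ((G (f k).1).2 (f k).2))%:E)%E.
    transitivity (\sum_(k <oo) v (f k))%E; last first.
      by apply: eq_eseriesr => k _; rewrite /v /uncurry; case: (f k).
    rewrite -(esum_pred_image v _ xpredT)//; last by move=> x y _ _; apply: inj; rewrite inE.
    congr esum.
    apply/seteqP; split=> // x _; exists (f^-1%FUN x) => //=.
    by rewrite invK ?inE.
  apply: (leb_outer_cover (a := fun k => (G (f k).1).1 (f k).2)
      (b := fun k => (G (f k).1).2 (f k).2)).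
    by move=> i; exact: (PG (f i).1).1.1.
  move=> t [i _] /(PG i).1.2 [j _ ijt]; exists (f^-1%FUN (i, j)) => //=.
  by rewrite invK ?inE.
rewrite (_ : esum _ _ = \sum_(i <oo) \sum_(j <oo ) v (i, j))%E; last first.
  pose J : nat -> set (nat * nat) := fun i => [set (i, j) | j in setT].
  rewrite (_ : setT = \bigcup_k J k); last first.
    by rewrite predeqE => -[x y]; split => // _; exists x => //; exists y.
  rewrite esum_bigcupT //=; last first.
    apply/trivIsetP => i j _ _ ij.
    rewrite predeqE => -[k m] /=; split => //= -[] [_] _ [<-{k} _].
    by move=> [m' _] [] /esym/eqP; rewrite (negbTE ij).
  rewrite -(image_id [set: nat]) -fun_true esum_pred_image//; last first.
    by move=> k _; exact: esum_ge0.
  apply: eq_eseriesr => /= j _.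
  rewrite -(esum_pred_image v (pair j) predT)//=; last 2 first.
  - by move=> k _; exact: (v_ge0 (j, k)).
  - by move=> ? ? _ _; exact: (@can_inj _ _ _ snd).
  by congr esum; rewrite predeqE => -[x y]; split; move=> [i _ <-]; exists i.
apply: lee_nneseries => i _; last exact: (PG i).2.
by move=> *; apply: nneseries_ge0 => *.
Qed.

HB.instance Definition _ := isOuterMeasure.Build R H (@leb_outer R n)
  leb_outer_set0 leb_outer_ge0 (@le_leb_outer) leb_outer_sigma_subadditive.

End OuterMeasure.

(** * Volume-preserving maps *)

Section Transformations.
Context {R : realType} {n : nat}.
Local Notation H := (heis R n).
Implicit Types (S T : set H) (a b p g : H).

Lemma leb_outer_image_le (f : H -> H) (k : R) : 0 < k ->
  (forall a b, box_le a b -> (leb_outer (f @` box a b) <= (k * box_vol a b)%:E)%E) ->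
  forall S, (leb_outer (f @` S) <= k%:E * leb_outer S)%E.
Proof.
move=> k0 hf S; rewrite -lee_pdivrMl//; apply: le_ereal_inf_tmp => _ [ab [hab hS] <-].
rewrite lee_pdivrMl// -nneseriesZl; last first.
  by move=> i _; rewrite lee_fin box_vol_ge0.
apply: (@le_trans _ _ (\sum_(0 <= i <oo) leb_outer (f @` box (ab.1 i) (ab.2 i)))%E).
  apply: le_trans (leb_outer_sigma_subadditive _); apply: le_leb_outer.
  by move=> _ [p /hS [i _ hi] <-]; exists i => //; exists p.
apply: lee_nneseries => [i *|i *]; first exact: leb_outer_ge0.
by rewrite -EFinM; exact: hf.
Qed.

(** Only an inequality is asked, so that exhibiting covers suffices to prove it; equality follows
    when a left inverse has the same property, by [volume_nonincr_cancel]. *)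
Definition volume_nonincr (f : H -> H) := forall S, (leb_outer (f @` S) <= leb_outer S)%E.

Lemma volume_nonincr_box (f : H -> H) :
  (forall a b, box_le a b -> (leb_outer (f @` box a b) <= (box_vol a b)%:E)%E) ->
  volume_nonincr f.
Proof.
move=> hf S; rewrite -[leRHS]mul1e; apply: leb_outer_image_le => // a b hab.
by rewrite mul1r; exact: hf.
Qed.

Lemma volume_nonincr_comp (f1 f2 : H -> H) :
  volume_nonincr f1 -> volume_nonincr f2 -> volume_nonincr (f1 \o f2).
Proof.
by move=> h1 h2 S; rewrite -image_comp; apply: le_trans (h1 _) (h2 _).
Qed.

Lemma volume_nonincr_eq (f1 f2 : H -> H) : f1 =1 f2 ->
  volume_nonincr f1 -> volume_nonincr f2.
Proof. by move=> /funext->. Qed.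

Lemma volume_nonincr_cancel (f1 f2 : H -> H) : volume_nonincr f1 -> volume_nonincr f2 ->
  cancel f1 f2 -> forall S, leb_outer (f1 @` S) = leb_outer S.
Proof.
move=> h1 h2 fK S; apply/eqP; rewrite eq_le h1/=.
have := h2 (f1 @` S); rewrite image_comp (_ : f2 \o f1 = id) ?image_id//.
exact/funext.
Qed.

Lemma heis_eqP p q : (forall j, hx p j = hx q j) -> (forall j, hy p j = hy q j) ->
  ht p = ht q -> p = q.
Proof.
case: p q => [[x y] t] [[x' y'] t']; rewrite /hx /hy /ht/=.
by move=> /funext-> /funext-> ->.
Qed.

Definition trans (c p : H) : H :=
  (fun j => hx p j + hx c j, fun j => hy p j + hy c j, ht p + ht c).

Lemma volume_nonincr_trans c : volume_nonincr (trans c).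
Proof.
apply: volume_nonincr_box => a b [h1 [h2 h3]].
have hab : box_le (trans c a) (trans c b).
  by split; [|split] => [j|j|]; rewrite lerD2r.
apply: (@le_trans _ _ (leb_outer (box (trans c a) (trans c b)))).
  apply: le_leb_outer => _ [p [k1 [k2 k3]] <-].
  by split; [|split] => [j|j|]; rewrite /trans /hx /hy /ht/= ?lerD2r ?ltrD2r;
    [exact: k1|exact: k2|exact: k3].
apply: le_trans (leb_outer_box_le hab) _; rewrite lee_fin /box_vol.
have E (u v w : R) : u + w - (v + w) = u - v by ring.
rewrite /trans /hx /hy /ht/= E.
under eq_bigr do rewrite E. under [in X in _ * X * _]eq_bigr do rewrite E.
exact: lexx.
Qed.

Definition swapxy p : H := (hy p, hx p, ht p).

Lemma volume_nonincr_swapxy : volume_nonincr swapxy.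
Proof.
apply: volume_nonincr_box => a b [h1 [h2 h3]].
apply: (@le_trans _ _ (leb_outer (box (swapxy a) (swapxy b)))).
  by apply: le_leb_outer => _ [p [k1 [k2 k3]] <-].
apply: le_trans (leb_outer_box_le _) _; first by [].
by rewrite lee_fin /box_vol [X in X * _]mulrC.
Qed.

Definition upd (x : 'I_n -> R) j v := fun k => if k == j then v else x k.

Lemma prod_upd (x x' : 'I_n -> R) j u v :
  \prod_k (upd x j u k - upd x' j v k) = (u - v) * \prod_(k | k != j) (x k - x' k).
Proof.
rewrite (bigD1 j)//= /upd eqxx; congr (_ * _).
by apply: eq_bigr => k /negPf->.
Qed.

Lemma interval_partition (l w x : R) (M : nat) : l <= x < l + M%:R * w ->
  exists2 i, (i < M)%N & l + i%:R * w <= x < l + i.+1%:R * w.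
Proof.
elim: M => [|M IH] /andP[h1 h2].
  by move: h2; rewrite mul0r addr0 ltNge h1.
have [h3|h3] := ltP x (l + M%:R * w); last by exists M => //; rewrite h3.
by have [|i iM hi] := IH; [rewrite h1|exists i => //; exact: ltnW].
Qed.

Definition shearx j (c : R) p : H := (hx p, hy p, ht p + c * hx p j).

(** The sheared box is cut into [M] slices of width [w] across direction [j]. On a slice the added
    height varies by at most [|c| w], so its image fits in a box only [2 |c| w] taller than the
    original; the total excess volume is of order [1 / M]. *)
Lemma volume_nonincr_shearx j c : volume_nonincr (shearx j c).
Proof.
apply: volume_nonincr_box => a b hab; have [h1 [h2 h3]] := hab.
apply/lee_addgt0Pr => e e0.
set area := (\prod_(k | k != j) (hx b k - hx a k)) * (\prod_k (hy b k - hy a k)).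
have area0 : 0 <= area.
  by rewrite mulr_ge0// prodr_ge0// => k _; rewrite subr_ge0.
set d := hx b j - hx a j; have d0 : 0 <= d by rewrite subr_ge0.
(* The total excess volume is [d * area * (2 * |c| * d) / M], which this choice makes smaller than
   [e]. *)
pose M := (Num.truncn (d * area * (2 * `|c| * d) / e)).+1.
have hM : d * area * (2 * `|c| * d) / e < M%:R by exact: truncnS_gt.
have M0 : 0 < M%:R :> R by rewrite ltr0n.
pose w := d / M%:R.
have w0 : 0 <= w by rewrite divr_ge0// ltW.
pose l i := hx a j + i%:R * w.
have lS i : l i.+1 = l i + w by rewrite /l -natr1; ring.
pose A i : H := (upd (hx a) j (l i), hy a, ht a + c * l i - `|c| * w).
pose B i : H := (upd (hx b) j (l i.+1), hy b, ht b + c * l i + `|c| * w).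
have hAB i : box_le (A i) (B i).
  split; [|split] => //=.
  - move=> k; change (upd (hx a) j (l i) k <= upd (hx b) j (l i.+1) k).
    by rewrite /upd; case: eqP => // _; rewrite lS lerDl.
  - rewrite /A /B /ht/=; have : 0 <= `|c| * w by rewrite mulr_ge0.
    by move: h3; rewrite /ht; lra.
have volAB i : box_vol (A i) (B i) = w * area * (ht b - ht a + 2 * (`|c| * w)).
  rewrite /box_vol /A /B /= {1 2 3 4 5 6}/hx {1 2 3 4 5 6}/hy {1 2 3 4}/ht /= prod_upd lS.
  by rewrite /area /hx /hy /ht; ring.
have cov : shearx j c @` box a b `<=` \big[setU/set0]_(i < M) box (A i) (B i).
  move=> _ [p [k1 [k2 k3]] <-]; rewrite -(bigcup_mkord M (fun i => box (A i) (B i))).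
  have [|i iM /andP[hi1 hi2]] := @interval_partition (hx a j) w (hx p j) M.
    rewrite /w mulrCA divff ?mulr1 ?gt_eqF// /d addrC subrK; exact: k1.
  exists i => //; rewrite -/(l i) in hi1; rewrite -/(l i.+1) in hi2.
  split; [|split] => /=.
  - move=> k; change (upd (hx a) j (l i) k <= hx p k < upd (hx b) j (l i.+1) k).
    rewrite /upd; case: eqP => [->|_]; last exact: k1.
    by rewrite hi1 hi2.
  - exact: k2.
  - rewrite /A /B /shearx /ht/=; move: k3; rewrite /ht => /andP[k3 k4].
    have : `|c * (hx p j - l i)| <= `|c| * w.
      rewrite normrM ler_wpM2l// ger0_norm ?subr_ge0// lerBlDl -lS; exact: ltW.
    by rewrite ler_norml mulrBr => /andP[? ?]; apply/andP; split; lra.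
apply: (le_trans (le_leb_outer cov)).
have sub := outer_measure_subadditive (@leb_outer R n) (fun i => box (A i) (B i)) M.
apply: (le_trans sub).
apply: (@le_trans _ _ (\sum_(i < M) (box_vol (A i) (B i))%:E)%E).
  by apply: lee_sum => i _; exact: leb_outer_box_le.
rewrite sumEFin -EFinD lee_fin.
under eq_bigr do rewrite volAB.
rewrite sumr_const card_ord -[leLHS]mulr_natl.
have -> : box_vol a b = d * area * (ht b - ht a).
  by rewrite /box_vol (bigD1 j)//= /area !mulrA.
have -> : M%:R * (w * area * (ht b - ht a + 2 * (`|c| * w))) =
  d * area * (ht b - ht a) + d * area * (2 * `|c| * d) / M%:R.
  by rewrite /w; field; rewrite gt_eqF.
by rewrite lerD2l ler_pdivrMr// [e * _]mulrC -ler_pdivrMr// ltW.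
Qed.

Definition sheary j (c : R) p : H := (hx p, hy p, ht p + c * hy p j).

Lemma volume_nonincr_sheary j c : volume_nonincr (sheary j c).
Proof.
apply: (@volume_nonincr_eq (swapxy \o (shearx j c \o swapxy))).
  by move=> p; apply: heis_eqP.
by apply: volume_nonincr_comp; [|apply: volume_nonincr_comp];
  [exact: volume_nonincr_swapxy|exact: volume_nonincr_shearx|exact: volume_nonincr_swapxy].
Qed.

Definition affine (al be : 'I_n -> R) (c p : H) : H :=
  (fun j => hx p j + hx c j, fun j => hy p j + hy c j,
   ht p + \sum_j (al j * hx p j + be j * hy p j) + ht c).

(** Such a map is a composition of one shear per coordinate and a Euclidean translation. Left and
    right multiplications of the group have this form because [im_herm] is linear in each
    argument. *)
Lemma volume_nonincr_affine al be c : volume_nonincr (affine al be c).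
Proof.
pose sh (s : seq 'I_n) (p : H) : H := (hx p, hy p,
  ht p + \sum_(j <- s) (al j * hx p j + be j * hy p j)).
suff h s : volume_nonincr (sh s).
  apply: (@volume_nonincr_eq (trans c \o sh (index_enum 'I_n))) => //.
  exact: volume_nonincr_comp (volume_nonincr_trans c) (h _).
elim: s => [|j s IH].
  apply: (@volume_nonincr_eq id) => [p|S]; last by rewrite image_id.
  by apply: heis_eqP => //=; rewrite /sh /ht/= big_nil addr0.
apply: (@volume_nonincr_eq (shearx j (al j) \o (sheary j (be j) \o sh s))).
  by move=> p; apply: heis_eqP => //=; rewrite /shearx /sheary /sh /ht /hx /hy/= big_cons; ring.
apply: volume_nonincr_comp; first exact: volume_nonincr_shearx.
by apply: volume_nonincr_comp; first exact: volume_nonincr_sheary.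
Qed.

Lemma volume_nonincr_lmul g : volume_nonincr (hmul g).
Proof.
apply: (@volume_nonincr_eq (affine (fun j => 2^-1 * hy g j) (fun j => - (2^-1 * hx g j)) g)).
  2: exact: volume_nonincr_affine.
move=> p; have E : \sum_j (2^-1 * hy g j * hx p j + - (2^-1 * hx g j) * hy p j) =
    2^-1 * im_herm g p.
  by rewrite /im_herm mulr_sumr; apply: eq_bigr => j _; ring.
apply: heis_eqP => [j|j|]; first exact: addrC; first exact: addrC.
by rewrite /affine /hmul {1}/ht/= E {4}/ht/=; ring.
Qed.

Lemma volume_nonincr_rmul g : volume_nonincr (fun p => hmul p g).
Proof.
apply: (@volume_nonincr_eq (affine (fun j => - (2^-1 * hy g j)) (fun j => 2^-1 * hx g j) g)).
  2: exact: volume_nonincr_affine.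
move=> p; have E : \sum_j (- (2^-1 * hy g j) * hx p j + 2^-1 * hx g j * hy p j) =
    2^-1 * im_herm p g.
  by rewrite /im_herm mulr_sumr; apply: eq_bigr => j _; ring.
apply: heis_eqP => [j|j|] //.
by rewrite /affine /hmul {1}/ht/= E {4}/ht/=; ring.
Qed.

Definition dil (r : R) (p : H) : H :=
  (fun j => r * hx p j, fun j => r * hy p j, r ^+ 2 * ht p).

(** The exponent is the homogeneous dimension: one power of [r] for each of the [2n] horizontal
    coordinates and two for the vertical one. *)
Lemma leb_outer_dil r S : 0 < r ->
  (leb_outer (dil r @` S) <= (r ^+ (n + n + 2))%:E * leb_outer S)%E.
Proof.
move=> r0; apply: leb_outer_image_le => [|a b [h1 [h2 h3]]]; first exact: exprn_gt0.
have r20 : 0 < r ^+ 2 by exact: exprn_gt0.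
have hab : box_le (dil r a) (dil r b).
  by split; [|split] => [j|j|]; rewrite /dil /hx /hy /ht/= ler_pM2l//;
    [exact: h1|exact: h2].
apply: (@le_trans _ _ (leb_outer (box (dil r a) (dil r b)))).
  apply: le_leb_outer => _ [p [k1 [k2 k3]] <-].
  by split; [|split] => [j|j|]; rewrite /dil /hx /hy /ht/= ler_pM2l// ltr_pM2l//;
    [exact: k1|exact: k2].
apply: le_trans (leb_outer_box_le hab) _; rewrite lee_fin /box_vol.
rewrite /dil {1 2}/hx {1 2}/hy {1 2}/ht/=.
under eq_bigr do rewrite -mulrBr. under [in X in _ * X * _]eq_bigr do rewrite -mulrBr.
by rewrite -mulrBr !big_split/= !prodr_const card_ord !exprD le_eqVlt; apply/orP; left; apply/eqP; ring.
Qed.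

End Transformations.

(** * Measurable sets and positive definiteness *)

Section Caratheodory.
Context {R : realType} {n : nat}.
Local Notation H := (heis R n).
Implicit Types (S T A D : set H) (a b p g : H).

(** An arbitrary test set is replaced by a cover by boxes, and the splitting inequality is summed
    over the cover. *)
Lemma leb_measurable_box A :
  (forall a b, box_le a b ->
    (leb_outer (box a b `&` A) + leb_outer (box a b `&` ~` A) <= (box_vol a b)%:E)%E) ->
  leb_measurable A.
Proof.
move=> hA; apply: le_caratheodory_measurable => X.
apply: le_ereal_inf_tmp => _ [ab [hab hX] <-].
have cov T : (leb_outer (X `&` T) <=
    \sum_(0 <= i <oo) leb_outer (box (ab.1 i) (ab.2 i) `&` T))%E.
  apply: le_trans (leb_outer_sigma_subadditive _); apply: le_leb_outer.
  by move=> p [/hX [i _ hi] hT]; exists i.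
apply: (le_trans (leeD (cov A) (cov (~` A)))).
rewrite -nneseriesD => [|i *|i *]; try exact: leb_outer_ge0.
apply: lee_nneseries => [i *|i *]; last exact: hA.
by apply: adde_ge0; exact: leb_outer_ge0.
Qed.

Lemma leb_measurable_preimage (f g : H -> H) A : volume_nonincr f -> volume_nonincr g ->
  cancel f g -> leb_measurable A -> leb_measurable (f @^-1` A).
Proof.
move=> hf hg fK hA E.
have inv := volume_nonincr_cancel hf hg fK.
rewrite -(inv E) (hA (f @` E)); congr (_ + _)%E.
- rewrite -[RHS]inv; congr leb_outer; apply/seteqP; split.
    by move=> _ [[p Ep <-] Afp]; exists p.
  by move=> _ [p [Ep Afp] <-]; split => //; exists p.
- rewrite -[RHS]inv; congr leb_outer; apply/seteqP; split.
    by move=> _ [[p Ep <-] Afp]; exists p.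
  by move=> _ [p [Ep Afp] <-]; split => //; exists p.
Qed.

Lemma leb_measurable_ht_lt c : leb_measurable [set p : H | ht p < c].
Proof.
apply: leb_measurable_box => a b [h1 [h2 h3]].
(* [m] is [c] clamped to the vertical extent of the box, so cutting at height [m] gives two genuine
   boxes, one possibly empty, whose volumes add up. *)
pose m := Num.max (ht a) (Num.min (ht b) c).
have [m1 m2] : ht a <= m /\ m <= ht b.
  by rewrite /m le_max lexx ge_max h3 ge_min lexx.
pose b' : H := (hx b, hy b, m); pose a' : H := (hx a, hy a, m).
have hb : box_le a b' by [].
have ha : box_le a' b by [].
have -> : box_vol a b = box_vol a b' + box_vol a' b.
  by rewrite /box_vol /a' /b' /hx /hy /ht/=; ring.
rewrite EFinD; apply: leeD.
  apply: le_trans (leb_outer_box_le hb); apply: le_leb_outer.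
  move=> p [[k1 [k2 /andP[k3 k4]]] /= k5]; split; [|split] => //.
  by rewrite k3 /b' {2}/ht/= /m lt_max lt_min k4 k5 orbT.
apply: le_trans (leb_outer_box_le ha); apply: le_leb_outer.
move=> p [[k1 [k2 /andP[k3 k4]]] /= /negP k5]; split; [|split] => //.
rewrite k4 andbT; change (m <= ht p).
by rewrite /m ge_max k3 ge_min [c <= _]leNgt k5 orbT.
Qed.

Lemma leb_measurable_hx_lt j c : leb_measurable [set p : H | hx p j < c].
Proof.
apply: leb_measurable_box => a b [h1 [h2 h3]].
pose m := Num.max (hx a j) (Num.min (hx b j) c).
have [m1 m2] : hx a j <= m /\ m <= hx b j.
  by rewrite /m le_max lexx ge_max h1 ge_min lexx.
pose b' : H := (upd (hx b) j m, hy b, ht b); pose a' : H := (upd (hx a) j m, hy a, ht a).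
have hb : box_le a b'.
  split; [move=> k; change (hx a k <= upd (hx b) j m k)|by split].
  by rewrite /upd; case: eqP => [->|_].
have ha : box_le a' b.
  split; [move=> k; change (upd (hx a) j m k <= hx b k)|by split].
  by rewrite /upd; case: eqP => [->|_].
have updK (x : 'I_n -> R) : x = upd x j (x j).
  by apply/funext => k; rewrite /upd; case: eqP => [->|].
have -> : box_vol a b = box_vol a b' + box_vol a' b.
  have E1 : box_vol a b' = (m - hx a j) * \prod_(k | k != j) (hx b k - hx a k) *
      (\prod_k (hy b k - hy a k)) * (ht b - ht a).
    by rewrite -prod_upd -updK.
  have E2 : box_vol a' b = (hx b j - m) * \prod_(k | k != j) (hx b k - hx a k) *
      (\prod_k (hy b k - hy a k)) * (ht b - ht a).
    by rewrite -prod_upd -updK.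
  by rewrite E1 E2 /box_vol (bigD1 j)//=; ring.
rewrite EFinD; apply: leeD.
  apply: le_trans (leb_outer_box_le hb); apply: le_leb_outer.
  move=> p [[k1 [k2 k3]] /= k5]; split; [|by split] => k.
  change (hx a k <= hx p k < upd (hx b) j m k).
  rewrite /upd; case: eqP => [->|_]; last exact: k1.
  by have /andP[-> /=] := k1 j; rewrite /m lt_max lt_min k5 => ->; rewrite orbT.
apply: le_trans (leb_outer_box_le ha); apply: le_leb_outer.
move=> p [[k1 [k2 k3]] /= /negP k5]; split; [|by split] => k.
change (upd (hx a) j m k <= hx p k < hx b k).
rewrite /upd; case: eqP => [->|_]; last exact: k1.
by have /andP[k6 ->] := k1 j; rewrite /m ge_max k6 ge_min [c <= _]leNgt k5 orbT.
Qed.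

Lemma leb_measurable_hy_lt j c : leb_measurable [set p : H | hy p j < c].
Proof.
apply: (@leb_measurable_preimage (@swapxy R n) (@swapxy R n) _ _ _ _ (@leb_measurable_hx_lt j c)).
- exact: volume_nonincr_swapxy.
- exact: volume_nonincr_swapxy.
- by move=> [[]].
Qed.

Definition vol S : R := fine (leb_outer S).

Lemma vol_ge0 S : 0 <= vol S.
Proof. exact/fine_ge0/leb_outer_ge0. Qed.

Lemma vol_set0 : vol set0 = 0.
Proof. by rewrite /vol leb_outer_set0. Qed.

Lemma vol_fin S T : S `<=` T -> (leb_outer T < +oo)%E -> leb_outer S \is a fin_num.
Proof.
move=> /le_leb_outer ST hT; rewrite ge0_fin_numE ?leb_outer_ge0//.
exact: le_lt_trans ST hT.
Qed.

Lemma le_vol S T : S `<=` T -> (leb_outer T < +oo)%E -> vol S <= vol T.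
Proof.
by move=> ST hT; rewrite fine_le// ?(vol_fin _ hT)//; exact: le_leb_outer.
Qed.

Lemma vol_split S A : leb_measurable A -> (leb_outer S < +oo)%E ->
  vol S = vol (S `&` A) + vol (S `&` ~` A).
Proof.
move=> hA hS; rewrite /vol [in LHS]hA fineD//; apply: vol_fin hS => //; exact: subIsetl.
Qed.

(** The expression is the integral over [D] of the square of [c0] plus the sum of the [c i] times
    the indicators of the [A i]. No integral is used: by induction on [s], the domain is split along
    [A k], and on the part inside [A k] the constant [c0] becomes [c0 + c k]. The alternative on
    [c0] admits a domain of infinite measure, where [vol D] is the default value of [fine]. *)
Lemma vol_gram_aux (I : Type) (c : I -> R) (A : I -> set H) (s : seq I) D c0 :
  (forall i, leb_measurable (A i)) -> (forall i, leb_outer (A i) < +oo)%E ->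
  (c0 = 0 \/ (leb_outer D < +oo)%E) ->
  0 <= \sum_(i <- s) \sum_(j <- s) c i * c j * vol (D `&` (A i `&` A j))
     + 2 * c0 * \sum_(i <- s) c i * vol (D `&` A i) + c0 ^+ 2 * vol D.
Proof.
move=> mA fA; elim: s D c0 => [|k s IH] D c0 hD.
  by rewrite !big_nil mulr0 !add0r mulr_ge0 ?sqr_ge0 ?vol_ge0.
have fDA : (leb_outer (D `&` A k) < +oo)%E.
  by apply: le_lt_trans (fA k); apply: le_leb_outer; exact: subIsetr.
have i1 := IH (D `&` A k) (c0 + c k) (or_intror fDA).
have hD2 : c0 = 0 \/ (leb_outer (D `&` ~` A k) < +oo)%E.
  case: hD => [|hD]; [by left|right]; apply: le_lt_trans hD.
  by apply: le_leb_outer; exact: subIsetl.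
have i2 := IH (D `&` ~` A k) c0 hD2.
have sp S : (leb_outer S < +oo)%E ->
    vol (D `&` S) = vol (D `&` A k `&` S) + vol (D `&` ~` A k `&` S).
  move=> hS; rewrite (vol_split (mA k)); first by congr (vol _ + vol _); rewrite setIAC.
  by apply: le_lt_trans hS; apply: le_leb_outer; exact: subIsetr.
have spD : c0 ^+ 2 * vol D = c0 ^+ 2 * vol (D `&` A k) + c0 ^+ 2 * vol (D `&` ~` A k).
  by case: hD => [->|hD]; [rewrite expr0n !mul0r addr0|rewrite (vol_split (mA k) hD) mulrDr].
have fI i j : (leb_outer (A i `&` A j) < +oo)%E.
  by apply: le_lt_trans (fA i); apply: le_leb_outer; exact: subIsetl.
have E1 : \sum_(i <- k :: s) c i * vol (D `&` A i) = c k * vol (D `&` A k) +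
    \sum_(i <- s) c i * vol (D `&` A k `&` A i) +
    \sum_(i <- s) c i * vol (D `&` ~` A k `&` A i).
  rewrite big_cons -addrA -big_split/=; congr (_ + _).
  by apply: eq_bigr => i _; rewrite (sp (A i) (fA i)) mulrDr.
have E2 : \sum_(i <- k :: s) \sum_(j <- k :: s) c i * c j * vol (D `&` (A i `&` A j)) =
    c k ^+ 2 * vol (D `&` A k) + 2 * c k * \sum_(i <- s) c i * vol (D `&` A k `&` A i) +
    \sum_(i <- s) \sum_(j <- s) c i * c j * vol (D `&` A k `&` (A i `&` A j)) +
    \sum_(i <- s) \sum_(j <- s) c i * c j * vol (D `&` ~` A k `&` (A i `&` A j)).
  rewrite big_cons [in LHS]big_cons setIid -expr2.
  have -> : \sum_(j <- s) c k * c j * vol (D `&` (A k `&` A j)) =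
      c k * \sum_(i <- s) c i * vol (D `&` A k `&` A i).
    by rewrite mulr_sumr; apply: eq_bigr => j _; rewrite setIA mulrA.
  have -> : \sum_(i <- s) \sum_(j <- k :: s) c i * c j * vol (D `&` (A i `&` A j)) =
      c k * \sum_(i <- s) c i * vol (D `&` A k `&` A i) +
      (\sum_(i <- s) \sum_(j <- s) c i * c j * vol (D `&` A k `&` (A i `&` A j)) +
       \sum_(i <- s) \sum_(j <- s) c i * c j * vol (D `&` ~` A k `&` (A i `&` A j))).
    rewrite mulr_sumr -!big_split/=; apply: eq_bigr => i _.
    rewrite big_cons -big_split/=; congr (_ + _).
      by rewrite (setIC (A i)) setIA; ring.
    by apply: eq_bigr => j _; rewrite (sp _ (fI i j)) mulrDr.
  by ring.
rewrite E1 E2 spD.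
apply: le_trans (addr_ge0 i1 i2) _.
by rewrite le_eqVlt; apply/orP; left; apply/eqP; ring.
Qed.

Lemma vol_gram (I : finType) (c : I -> R) (A : I -> set H) :
  (forall i, leb_measurable (A i)) -> (forall i, leb_outer (A i) < +oo)%E ->
  0 <= \sum_i \sum_j c i * c j * vol (A i `&` A j).
Proof.
move=> mA fA; have := @vol_gram_aux I c A (index_enum I) setT 0 mA fA (or_introl erefl).
rewrite mulr0 expr0n !mul0r !addr0 => /le_trans; apply.
by apply: ler_sum => i _; apply: ler_sum => j _; rewrite setTI.
Qed.

Let U := caratheodory_type (@leb_outer R n).

Lemma measurable_fun_leb (f : H -> R) : (forall c, leb_measurable [set p | f p < c]) ->
  measurable_fun [set: U] (f : U -> R).
Proof.
move=> hf mD; apply: (measurability _ (measurable_realfun.RGenInftyO.measurableE R)) => //.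
by move=> _ [_ [c ->] <-]; rewrite setTI set_itvNyo; exact: hf.
Qed.

Lemma sqrtr_lt (x r : R) : 0 < r -> (Num.sqrt x < r) = (x < r ^+ 2).
Proof.
move=> r0; rewrite -{1}[r]gtr0_norm// -sqrtr_sqr ltr_sqrt//; exact: exprn_gt0.
Qed.

Lemma koranyi_lt p r : 0 < r ->
  (koranyi p < r) = (znorm2 p ^+ 2 + ht p ^+ 2 < r ^+ 4).
Proof.
move=> r0; rewrite /koranyi !sqrtr_lt// ?exprn_gt0//.
by rewrite -exprM.
Qed.

Definition hone : H := (fun=> 0, fun=> 0, 0).

Lemma hmul1h p : hmul (hinv hone) p = p.
Proof.
have E : im_herm (hinv hone) p = 0.
  by rewrite /im_herm big1// => j _; rewrite /hinv /hx /hy/=; ring.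
apply: heis_eqP => [j|j|]; rewrite /hmul ?E /hinv /hone /hx /hy /ht/=; ring.
Qed.

Lemma kball_gt0 (a : H) r x : kball a r x -> 0 < r.
Proof. by apply: le_lt_trans; exact: sqrtr_ge0. Qed.

(** The ball is a sublevel set of a polynomial in the coordinates, and the coordinates are
    measurable for the Carathéodory sigma-algebra since half-spaces are. *)
Lemma leb_measurable_kball0 r : leb_measurable (kball hone r : set H).
Proof.
have [r0|r0] := leP r 0.
  have -> : kball hone r = set0.
    by apply/seteqP; split => // x /kball_gt0; rewrite ltNge r0.
  exact: (@measurable0 _ U).
have mx j : measurable_fun [set: U] (fun p : U => hx (p : H) j).
  by apply: measurable_fun_leb => c; exact: leb_measurable_hx_lt.
have my j : measurable_fun [set: U] (fun p : U => hy (p : H) j).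
  by apply: measurable_fun_leb => c; exact: leb_measurable_hy_lt.
have mt : measurable_fun [set: U] (fun p : U => ht (p : H)).
  by apply: measurable_fun_leb => c; exact: leb_measurable_ht_lt.
have mf : measurable_fun [set: U] (fun p : U => znorm2 (p : H) ^+ 2 + ht (p : H) ^+ 2).
  apply: measurable_funD; apply: measurable_funX => //.
  by apply: measurable_sum => j; apply: measurable_funD; exact: measurable_funX.
have -> : kball hone r = (fun p : U => znorm2 (p : H) ^+ 2 + ht (p : H) ^+ 2) @^-1` `]-oo, (r ^+ 4)[.
  apply/seteqP; split => p; rewrite /kball /= hmul1h in_itv/= koranyi_lt//.
by have := mf measurableT _ (measurable_itv `]-oo, (r ^+ 4)[); rewrite setTI.
Qed.

End Caratheodory.

(** * Korányi balls *)

Section Group.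
Context {R : realType} {n : nat}.
Local Notation H := (heis R n).
Implicit Types (S T A : set H) (a b p q g : H).

Lemma ht_hmul p q : ht (hmul p q) = ht p + ht q + 2^-1 * im_herm p q.
Proof. by []. Qed.

Lemma hmulA p q g : hmul (hmul p q) g = hmul p (hmul q g).
Proof.
have E : im_herm (hmul p q) g + im_herm p q = im_herm p (hmul q g) + im_herm q g.
  rewrite /im_herm -!big_split; apply: eq_bigr => j _.
  by rewrite /hmul /hx /hy /=; ring.
apply: heis_eqP => [j|j|]; [exact/esym/addrA|exact/esym/addrA|].
rewrite !ht_hmul; have := congr1 (fun z => 2^-1 * z) E; rewrite !mulrDr; lra.
Qed.

Lemma hmulK g p : hmul (hinv g) (hmul g p) = p.
Proof.
have E : im_herm (hinv g) (hmul g p) = - im_herm g p.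
  rewrite /im_herm -sumrN; apply: eq_bigr => j _.
  by rewrite /hmul /hinv /hx /hy /=; ring.
apply: heis_eqP => [j|j|]; [exact: addKr|exact: addKr|].
by rewrite !ht_hmul E (_ : ht (hinv g) = - ht g)//; ring.
Qed.

Lemma hmulVK g p : hmul g (hmul (hinv g) p) = p.
Proof.
have E : im_herm g (hmul (hinv g) p) = - im_herm (hinv g) p.
  rewrite /im_herm -sumrN; apply: eq_bigr => j _.
  by rewrite /hmul /hinv /hx /hy /=; ring.
apply: heis_eqP => [j|j|]; [exact: addNKr|exact: addNKr|].
by rewrite !ht_hmul E (_ : ht (hinv g) = - ht g)//; ring.
Qed.

Lemma kballE a r : kball a r = hmul (hinv a) @^-1` kball hone r.
Proof. by apply/seteqP; split => x; rewrite /kball /= hmul1h. Qed.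

Lemma leb_measurable_kball a r : leb_measurable (kball a r).
Proof.
rewrite kballE; apply: (@leb_measurable_preimage _ _ _ (hmul a)).
- exact: volume_nonincr_lmul.
- exact: volume_nonincr_lmul.
- exact: hmulVK.
- exact: leb_measurable_kball0.
Qed.

Lemma leb_outer_preimage (f g : H -> H) S : volume_nonincr f -> volume_nonincr g ->
  cancel f g -> cancel g f -> leb_outer (f @^-1` S) = leb_outer S.
Proof.
move=> hf hg fK gK; rewrite -(volume_nonincr_cancel hg hf gK S); congr leb_outer.
apply/seteqP; split => [p Sp|_ [p Sp <-]]; first by exists (f p).
by rewrite /preimage/= gK.
Qed.

Lemma leb_outer_kball a r : leb_outer (kball a r) = leb_outer (kball (hone : H) r).
Proof.
rewrite kballE; apply: (@leb_outer_preimage _ (hmul a)).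
- exact: volume_nonincr_lmul.
- exact: volume_nonincr_lmul.
- exact: hmulVK.
- exact: hmulK.
Qed.

Lemma znorm2_ge0 p : 0 <= znorm2 p.
Proof. by apply: sumr_ge0 => j _; rewrite addr_ge0 ?sqr_ge0. Qed.

Lemma sqr_le_znorm2 p j : hx p j ^+ 2 <= znorm2 p /\ hy p j ^+ 2 <= znorm2 p.
Proof.
have : hx p j ^+ 2 + hy p j ^+ 2 <= znorm2 p.
  by rewrite /znorm2 (bigD1 j)//= lerDl sumr_ge0// => k _; rewrite addr_ge0 ?sqr_ge0.
by have := sqr_ge0 (hx p j); have := sqr_ge0 (hy p j); lra.
Qed.

Lemma koranyi_ltP p r : 0 < r -> znorm2 p ^+ 2 + ht p ^+ 2 < r ^+ 4 ->
  znorm2 p < r ^+ 2 /\ `|ht p| < r ^+ 2.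
Proof.
move=> r0 h; have r20 : 0 < r ^+ 2 by exact: exprn_gt0.
have h4 : r ^+ 4 = r ^+ 2 ^+ 2 by rewrite -exprM.
split.
  rewrite -ltr_sqr ?nnegrE ?znorm2_ge0 ?(ltW r20)// -h4.
  by have := sqr_ge0 (ht p); lra.
rewrite -ltr_sqr ?nnegrE ?(ltW r20)// -h4 real_normK ?num_real//.
by have := sqr_ge0 (znorm2 p); lra.
Qed.

Lemma leb_outer_kball_fin a r : (leb_outer (kball a r) < +oo)%E.
Proof.
rewrite leb_outer_kball; have [r0|r0] := leP r 0.
  rewrite (_ : kball hone r = set0) ?leb_outer_set0//.
  by apply/seteqP; split => // x /kball_gt0; rewrite ltNge r0.
have r20 : 0 < r ^+ 2 by exact: exprn_gt0.
pose lo : H := (fun=> - r, fun=> - r, - r ^+ 2); pose up : H := (fun=> r, fun=> r, r ^+ 2).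
have hlu : box_le lo up by split; [|split] => [j|j|]; rewrite /lo /up /hx /hy /ht/=; lra.
apply: le_lt_trans (le_trans (le_leb_outer _) (leb_outer_box_le hlu)) (ltey _) => p.
rewrite /kball /= hmul1h koranyi_lt// => /(koranyi_ltP r0) [h1 h2].
have abs z : z ^+ 2 < r ^+ 2 -> - r <= z < r.
  rewrite -ltr_sqrt// !sqrtr_sqr (gtr0_norm r0) => /ltr_normlP [? ?].
  by apply/andP; split; lra.
split; [|split] => [j|j|].
- by apply: abs; apply: le_lt_trans h1; have [] := sqr_le_znorm2 p j.
- by apply: abs; apply: le_lt_trans h1; have [] := sqr_le_znorm2 p j.
- by move: h2; rewrite ltr_norml /lo /up {1 3}/ht/= => /andP[/ltW -> ->].
Qed.

Lemma znorm2_dil r p : znorm2 (dil r p) = r ^+ 2 * znorm2 p.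
Proof.
by rewrite /znorm2 mulr_sumr; apply: eq_bigr => j _; rewrite /dil /hx /hy/=; ring.
Qed.

(** After translation to the origin, the larger ball lies in the image of the smaller one under the
    dilation of ratio [3]. *)
Lemma vol_kball3 a r : vol (kball a (3 * r)) <= 3 ^+ (n + n + 2) * vol (kball a r).
Proof.
have fin b s := leb_outer_kball_fin b s.
suff h : (leb_outer (kball a (3 * r)) <=
    (3 ^+ (n + n + 2))%:E * leb_outer (kball a r))%E.
  by rewrite /vol -lee_fin EFinM !fineK// ge0_fin_numE ?leb_outer_ge0.
rewrite !(leb_outer_kball a); apply: le_trans (leb_outer_dil _ _) => //.
apply: le_leb_outer => p pr; have r0 : 0 < r.
  by move/kball_gt0 : pr; rewrite pmulr_rgt0.
move: pr; rewrite /kball/= hmul1h koranyi_lt ?mulr_gt0// => pr.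
exists (dil 3^-1 p); last first.
  by apply: heis_eqP => [j|j|]; rewrite /dil /hx /hy /ht/=; field.
rewrite hmul1h koranyi_lt// znorm2_dil {1}/dil {1}/ht/=.
by move: pr; rewrite !exprMn; lra.
Qed.

(** A crude substitute for the triangle inequality: the product has [znorm2] at most [4 r^2] and
    height at most [3 r^2] in absolute value, and [16 + 9 < 81]. *)
Lemma koranyi_hmul_lt p q r : koranyi p < r -> znorm2 q ^+ 2 + ht q ^+ 2 <= r ^+ 4 ->
  koranyi (hmul p q) < 3 * r.
Proof.
move=> pr; have r0 : 0 < r by apply: le_lt_trans pr; exact: sqrtr_ge0.
move: pr; rewrite koranyi_lt// => /(koranyi_ltP r0) [zp tp] hq.
have r20 : 0 < r ^+ 2 by exact: exprn_gt0.
have h4 : r ^+ 4 = r ^+ 2 ^+ 2 by rewrite -exprM.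
have zq : znorm2 q <= r ^+ 2.
  rewrite -ler_sqr ?nnegrE ?znorm2_ge0 ?(ltW r20)// -h4.
  by have := sqr_ge0 (ht q); lra.
have tq : `|ht q| <= r ^+ 2.
  rewrite -ler_sqr ?nnegrE ?(ltW r20)// -h4 real_normK ?num_real//.
  by have := sqr_ge0 (znorm2 q); lra.
have zpq : znorm2 (hmul p q) <= 2 * znorm2 p + 2 * znorm2 q.
  rewrite /znorm2 !mulr_sumr -big_split/=; apply: ler_sum => j _.
  have := sqr_ge0 (hx p j - hx q j); have := sqr_ge0 (hy p j - hy q j).
  by rewrite /hmul /hx /hy /=; lra.
have im : `|im_herm p q| <= znorm2 p + znorm2 q.
  rewrite /im_herm /znorm2 -big_split/=; apply: le_trans (ler_norm_sum _ _ _) _.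
  apply: ler_sum => j _; rewrite ler_norml.
  have := sqr_ge0 (hx p j - hy q j); have := sqr_ge0 (hy p j - hx q j).
  have := sqr_ge0 (hx p j + hy q j); have := sqr_ge0 (hy p j + hx q j).
  by move=> *; apply/andP; split; lra.
rewrite koranyi_lt ?mulr_gt0//.
have tpq : `|ht (hmul p q)| <= 3 * r ^+ 2.
  rewrite /hmul {1}/ht/=; move: tp tq im; rewrite !ler_norml !ltr_norml.
  by move=> /andP[? ?] /andP[? ?] /andP[? ?]; apply/andP; split; lra.
have z2 : znorm2 (hmul p q) ^+ 2 <= (4 * r ^+ 2) ^+ 2.
  by rewrite ler_sqr ?nnegrE ?znorm2_ge0//; lra.
have t2 : ht (hmul p q) ^+ 2 <= (3 * r ^+ 2) ^+ 2.
  by rewrite -real_normK ?num_real// ler_sqr ?nnegrE//; lra.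
have : 0 < r ^+ 4 by exact: exprn_gt0.
by move: z2 t2; rewrite !exprMn h4; lra.
Qed.

End Group.

(** * The correlation function of a set *)

Section Correlation.
Context {R : realType} {n : nat}.
Local Notation H := (heis R n).
Variable j0 : 'I_n.
Implicit Types (S T A : set H) (p q g : H) (a b c d : R).

Definition planar a b : H := (fun j => if j == j0 then a else 0, fun=> 0, b).

Lemma im_herm_planar p a b : im_herm p (planar a b) = hy p j0 * a.
Proof.
rewrite /im_herm (bigD1 j0)//= /planar {1}/hx {2}/hy/= eqxx mulr0 subr0 big1 ?addr0//.
by move=> j /negPf jj; rewrite {1}/hx {2}/hy/= jj !mulr0 subr0.
Qed.

(** The form [im_herm] vanishes between two planar points, so their product is additive and right
    translation by them is an action of the plane. *)
Lemma hmul_planar p a b c d :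
  hmul (hmul p (planar a b)) (planar c d) = hmul p (planar (a + c) (b + d)).
Proof.
rewrite hmulA; congr hmul; apply: heis_eqP => [j|j|].
- by rewrite /hmul /hx/=; case: eqP; rewrite ?addr0.
- exact: addr0.
- by rewrite ht_hmul im_herm_planar mul0r mulr0 addr0.
Qed.

Lemma hmul_vertical p b : hmul p (planar 0 b) = (hx p, hy p, ht p + b).
Proof.
apply: heis_eqP => [j|j|].
- by rewrite /hmul /planar /hx/= if_same addr0.
- exact: addr0.
- by rewrite ht_hmul im_herm_planar !mulr0 addr0.
Qed.

Lemma hmul_planar0 p : hmul p (planar 0 0) = p.
Proof.
by rewrite hmul_vertical addr0; apply: heis_eqP.
Qed.

Lemma planar_norm a b : znorm2 (planar a b) ^+ 2 + ht (planar a b) ^+ 2 = a ^+ 4 + b ^+ 2.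
Proof.
rewrite /znorm2 (bigD1 j0)//= {1}/hx {1}/hy/= eqxx expr0n addr0 big1 ?addr0 -?exprM//.
by move=> j /negPf jj; rewrite /hx /hy/= jj !expr0n addr0.
Qed.

Definition pshift A a b : set H := [set p | A (hmul p (planar a b))].

Lemma pshiftD A a b c d : pshift (pshift A a b) c d = pshift A (c + a) (d + b).
Proof. by apply/seteqP; split => p; rewrite /pshift /= hmul_planar. Qed.

Lemma pshift0 A : pshift A 0 0 = A.
Proof. by apply/seteqP; split => p; rewrite /pshift /= hmul_planar0. Qed.

Lemma planarK a b : cancel (fun p => hmul p (planar a b)) (fun p => hmul p (planar (- a) (- b))).
Proof. by move=> p; rewrite hmul_planar !subrr hmul_planar0. Qed.

Lemma planarVK a b : cancel (fun p => hmul p (planar (- a) (- b))) (fun p => hmul p (planar a b)).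
Proof. by move=> p; rewrite hmul_planar !addNr hmul_planar0. Qed.

Lemma leb_outer_pshift A a b : leb_outer (pshift A a b) = leb_outer A.
Proof.
apply: (leb_outer_preimage (f := fun p => hmul p (planar a b))
  (g := fun p => hmul p (planar (- a) (- b)))).
- exact: volume_nonincr_rmul.
- exact: volume_nonincr_rmul.
- exact: planarK.
- exact: planarVK.
Qed.

Lemma leb_measurable_pshift A a b : leb_measurable A -> leb_measurable (pshift A a b).
Proof.
apply: (leb_measurable_preimage (f := fun p => hmul p (planar a b))
  (g := fun p => hmul p (planar (- a) (- b)))).
- exact: volume_nonincr_rmul.
- exact: volume_nonincr_rmul.
- exact: planarK.
Qed.

Variable A : set H.
Hypothesis mA : leb_measurable A.
Hypothesis fA : (leb_outer A < +oo)%E.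

Definition corr a b := vol (A `&` pshift A a b).

Lemma corr0 : corr 0 0 = vol A.
Proof. by rewrite /corr pshift0 setIid. Qed.

Lemma corr_ge0 a b : 0 <= corr a b.
Proof. exact: vol_ge0. Qed.

(** Invariance of the measure under right translation: the overlap of two translates depends only on
    the difference of the shifts, which turns Gram matrices into values of [corr]. *)
Lemma vol_pshiftI a b c d : vol (pshift A a b `&` pshift A c d) = corr (c - a) (d - b).
Proof.
rewrite /corr /vol -(leb_outer_pshift (A `&` pshift A (c - a) (d - b)) a b).
congr (fine (leb_outer _)).
rewrite -[in LHS](subrKC a c) -[in LHS](subrKC b d) -[in LHS]pshiftD.
by [].
Qed.

Lemma corr_pd (I : finType) (c x t : I -> R) :
  0 <= \sum_i \sum_j c i * c j * corr (x j - x i) (t j - t i).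
Proof.
apply: (le_trans (@vol_gram R n I c (fun i => pshift A (x i) (t i)) _ _)) => [i|i|].
- exact: leb_measurable_pshift.
- by rewrite leb_outer_pshift.
by apply: ler_sum => i _; apply: ler_sum => j _; rewrite vol_pshiftI.
Qed.

Lemma corrN a b : corr (- a) (- b) = corr a b.
Proof. by rewrite -[a in RHS]subr0 -[b in RHS]subr0 -vol_pshiftI setIC vol_pshiftI !sub0r. Qed.

(** Cauchy-Schwarz on [E] between the constant [1] and the sum of the indicators of the translates,
    all of which lie in [E]. *)
Lemma corr_sum_ge (E : set H) (I : finType) (x t : I -> R) : (leb_outer E < +oo)%E ->
  (forall i, pshift A (x i) (t i) `<=` E) ->
  #|I|%:R ^+ 2 * vol A ^+ 2 <= vol E * \sum_i \sum_j corr (x j - x i) (t j - t i).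
Proof.
move=> fE hE; set S := \sum_i _.
have [V0|V0] := leP (vol E) 0.
  have {}V0 : vol E = 0 by apply/eqP; rewrite eq_le V0 vol_ge0.
  rewrite V0 mul0r; have [->|] := eqVneq #|I| 0%N; first by rewrite expr0n mul0r.
  rewrite -lt0n => /card_gt0P[i _].
  have : vol A <= 0.
    rewrite -V0 /vol -(leb_outer_pshift A (x i) (t i)); exact: le_vol.
  by move=> A0; rewrite (_ : vol A = 0) ?expr0n ?mulr0//; apply/eqP; rewrite eq_le A0 vol_ge0.
(* The opposite of the mean over [E] of the sum of indicators: this constant minimises the quadratic
   form of [vol_gram_aux]. *)
pose l := - (#|I|%:R * vol A / vol E).
have h := @vol_gram_aux R n I (fun=> 1) (fun i => pshift A (x i) (t i)) (index_enum I) E l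
  (fun i => leb_measurable_pshift _ _ mA).
have fS i : (leb_outer (pshift A (x i) (t i)) < +oo)%E by rewrite leb_outer_pshift.
have E1 : \sum_i 1 * vol (E `&` pshift A (x i) (t i)) = #|I|%:R * vol A.
  rewrite -sumr_const mulr_suml; apply: eq_bigr => i _; congr (_ * _).
  by rewrite (_ : E `&` _ = pshift A (x i) (t i)) /vol ?leb_outer_pshift//; exact/setIidPr/hE.
have E2 : \sum_i \sum_j 1 * 1 * vol (E `&` (pshift A (x i) (t i) `&` pshift A (x j) (t j))) = S.
  apply: eq_bigr => i _; apply: eq_bigr => j _; rewrite !mul1r -vol_pshiftI; congr vol.
  by apply/setIidPr => p [/hE].
have {h} := h fS (or_intror fE); rewrite E1 E2 => h.
rewrite -exprMn -ler_pdivrMl//.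
have : l * vol E = - (#|I|%:R * vol A) by rewrite /l mulNr divfK// gt_eqF.
have -> : (vol E)^-1 * (#|I|%:R * vol A) ^+ 2 = - l * (#|I|%:R * vol A) by rewrite /l; ring.
by move=> lE; move: h; rewrite expr2 -[l * l * _]mulrA lE; lra.
Qed.

(** Continuity of vertical translation in measure. [A] is approximated from outside by a union of
    boxes; finitely many boxes carry almost all the volume, and a box differs from its vertical
    translate by a slab of volume proportional to the shift. *)
Lemma vertical_small e : 0 < e -> exists2 d, 0 < d &
  forall b, `|b| <= d -> vol (A `&` ~` pshift A 0 b) <= e.
Proof.
move=> e0; pose e3 := e / 4; have e30 : 0 < e3 by rewrite divr_gt0.
have fnA : leb_outer A \is a fin_num by rewrite ge0_fin_numE ?leb_outer_ge0.
have [_ [ab [hab hA] <-] hs] := lb_ereal_inf_adherent e30 fnA.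
rewrite -/(leb_outer A) in hs.
pose B i := box (ab.1 i) (ab.2 i); pose v i := (box_vol (ab.1 i) (ab.2 i))%:E.
rewrite -/(B _) in hA.
have v0 i : (0 <= v i)%E by rewrite lee_fin box_vol_ge0.
have sfin : (\sum_(0 <= i <oo) v i < +oo)%E.
  by apply: lt_trans hs _; rewrite -(fineK fnA) -EFinD ltey.
have [N _ hN] : exists2 N, True & (\sum_(N <= i <oo) v i <= e3%:E)%E.
  have : nbhs (0 : \bar R)%E [set x | (x < e3%:E)%E].
    by apply: open_nbhs_nbhs; split; [exact: open_ereal_lt_ereal|rewrite /= lte_fin].
  move=> /(nneseries_tail_cvg sfin (fun k _ => v0 k)) [N _ /(_ N (leqnn N)) /ltW hN].
  by exists N.
pose area i := (\prod_(j < n) (hx (ab.2 i) j - hx (ab.1 i) j)) *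
  (\prod_(j < n) (hy (ab.2 i) j - hy (ab.1 i) j)).
have area0 i : 0 <= area i.
  by have [h1 [h2 h3]] := hab i; rewrite mulr_ge0// prodr_ge0// => k _; rewrite subr_ge0.
pose s := \sum_(i < N) area i; have s0 : 0 <= s by exact: sumr_ge0.
(* The [N] slabs have total volume at most [s * |b|], which must not exceed [e3]; the added [1]
   covers the case [s = 0]. *)
exists (e3 / (s + 1)); first by rewrite divr_gt0// ltr_wpDl.
move=> b hb; pose U := \bigcup_i B i.
pose slab i : set H := B i `&` ~` pshift (B i) 0 b.
have hU : (leb_outer U <= leb_outer A + e3%:E)%E.
  apply: le_trans (leb_outer_sigma_subadditive _) (le_trans _ (ltW hs)).
  by apply: lee_nneseries => i *; [exact: leb_outer_ge0|exact: leb_outer_box_le].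
have hW : (leb_outer (U `&` ~` A) <= e3%:E)%E.
  have := mA U; have -> : U `&` A = A by apply/setIidPr => p /hA.
  by move=> hUA; move: hU; rewrite hUA leeD2lE.
have hslab i : (leb_outer (slab i) <= (area i * `|b|)%:E)%E.
  have [h1 [h2 h3]] := hab i.
  pose lo : H := (hx (ab.1 i), hy (ab.1 i), if 0 <= b then ht (ab.2 i) - b else ht (ab.1 i)).
  pose up : H := (hx (ab.2 i), hy (ab.2 i), if 0 <= b then ht (ab.2 i) else ht (ab.1 i) - b).
  have -> : area i * `|b| = box_vol lo up.
    rewrite /box_vol /area /lo /up /hx /hy /ht/=; congr (_ * _).
    by have [b0|b0] := leP 0 b; [rewrite ger0_norm//|rewrite ltr0_norm//]; ring.
  have hlu : box_le lo up.
    split; [|split] => //; rewrite /lo /up {1 4}/ht/=.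
    by have [b0|b0] := leP 0 b; lra.
  apply: le_trans (leb_outer_box_le hlu); apply: le_leb_outer => p [[k1 [k2 k3]] k4].
  split; [|split] => //; rewrite /lo /up {1 5}/ht/=.
  have [k5|k5] := pselect (ht (ab.1 i) <= ht p + b < ht (ab.2 i)).
    by exfalso; apply: k4; rewrite /pshift /= hmul_vertical.
  move: k3 => /andP[k3 k6]; move/negP: k5; rewrite negb_and -!ltNge -leNgt => k5.
  by apply/andP; split; have [b0|b0] := leP 0 b; move/orP: k5 => [k5|k5]; lra.
pose T := \bigcup_(i in ~` `I_N) B i.
have hT : (leb_outer T <= e3%:E)%E.
  apply: le_trans (outer_measure_sigma_subadditive_tail (@leb_outer R n) N B) (le_trans _ hN).
  by apply: lee_nneseries => i *; [exact: leb_outer_ge0|exact: leb_outer_box_le].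
pose W := pshift (U `&` ~` A) 0 b.
pose SL := \big[setU/set0]_(i < N) slab i.
have hSL : (leb_outer SL <= e3%:E)%E.
  apply: le_trans (outer_measure_subadditive (@leb_outer R n) slab N) _.
  apply: (@le_trans _ _ (\sum_(i < N) (area i * `|b|)%:E)%E).
    by apply: lee_sum => i _; exact: hslab.
  rewrite sumEFin lee_fin -mulr_suml -/s.
  apply: (@le_trans _ _ (s * (e3 / (s + 1)))); first by rewrite ler_wpM2l.
  rewrite mulrCA -[leRHS]mulr1 ler_pM2l// ler_pdivrMr ?mul1r ?lerDl//.
  by rewrite ltr_wpDl.
(* A point of [A] leaving [A] is either in a tail box, or leaves one of the first [N] boxes, or
   stays in its box and so lands in [U] outside [A]. Each event costs at most [e / 4]. *)
have cov : A `&` ~` pshift A 0 b `<=` T `|` SL `|` W.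
  move=> p [Ap nAp]; have [i _ Bi] := hA _ Ap.
  have [iN|iN] := ltnP i N; last by left; left; exists i => //=; rewrite /= ltnNge iN.
  have [Bp|nBp] := pselect (pshift (B i) 0 b p).
    by right; split => //; exists i.
  by left; right; rewrite /SL -(bigcup_mkord N slab); exists i.
rewrite /vol -lee_fin fineK; last by apply: (vol_fin _ fA) => p [].
apply: le_trans (le_leb_outer cov) _.
apply: le_trans (outer_measureU2 (@leb_outer R n) _ _) _.
apply: le_trans (leeD (outer_measureU2 (@leb_outer R n) _ _) (lexx _)) _.
have hW' : (leb_outer W <= e3%:E)%E by rewrite leb_outer_pshift.
apply: le_trans (leeD (leeD hT hSL) hW') _.
by rewrite -!EFinD lee_fin /e3; lra.
Qed.

(** The modulus is uniform in [a]: translating back by the first shift reduces the loss to that of a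
    purely vertical move of [A]. *)
Lemma corr_vertical e : 0 < e -> exists2 d, 0 < d &
  forall a b b', `|b' - b| <= d -> `|corr a b - corr a b'| <= e.
Proof.
move=> e0; have [d d0 hd] := vertical_small e0; exists d => // a b b' hb.
have key c c' : `|c' - c| <= d -> corr a c - corr a c' <= e.
  move=> hc; rewrite lerBlDr /corr addrC.
  have fI S : (leb_outer (A `&` S) < +oo)%E.
    by apply: le_lt_trans fA; apply: le_leb_outer; exact: subIsetl.
  rewrite (vol_split (leb_measurable_pshift a c' mA) (fI _)); apply: lerD.
    by apply: le_vol => // p [[Ap _] h].
  apply: le_trans (hd _ hc).
  rewrite /vol -(leb_outer_pshift (A `&` ~` pshift A 0 (c' - c)) a c).
  have E : pshift (A `&` ~` pshift A 0 (c' - c)) a c = pshift A a c `&` ~` pshift A a c'.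
    rewrite -[in RHS](addr0 a) -[in RHS](subrKC c c') -pshiftD.
    by rewrite addr0.
  rewrite E; apply: le_vol => [p [[Ap h] h']|] //.
  by apply: le_lt_trans fA; rewrite -(leb_outer_pshift A a c); apply: le_leb_outer => p [].
rewrite ler_norml; have := key b b' hb; have := key b' b; rewrite distrC => /(_ hb).
by move=> *; apply/andP; split; lra.
Qed.

End Correlation.

(** * Integration by parts for compositions *)

Section Calculus.
Context {R : realType}.
Implicit Types (x y a b : R) (f g : R -> R).

Lemma is_derive_continuous f df x : is_derive x 1 f df -> {for x, continuous f}.
Proof. by move=> [h _]; exact/differentiable_continuous/derivable1_diffP. Qed.

Lemma MVT_all f df a b : a <= b ->
  (forall x, a <= x <= b -> is_derive x 1 f (df x)) ->
  exists2 c, a <= c <= b & f b - f a = df c * (b - a).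
Proof.
move=> ab hf; have [| |c cab E] := @MVT_segment R f df a b ab.
- by move=> x; rewrite in_itv/= => /andP[/ltW ax /ltW xb]; apply: hf; rewrite ax.
- apply: continuous_in_subspaceT => x; rewrite inE/= in_itv/= => xab.
  exact: is_derive_continuous (hf x xab).
by exists c; rewrite // in_itv/= in cab.
Qed.

Lemma lip_of_derive f df a b (K : R) :
  (forall x, a <= x <= b -> is_derive x 1 f (df x)) ->
  (forall x, a <= x <= b -> `|df x| <= K) ->
  forall x y, a <= x <= b -> a <= y <= b -> `|f x - f y| <= K * `|x - y|.
Proof.
move=> hf hK; have key x y : a <= x <= b -> a <= y <= b -> x <= y -> `|f y - f x| <= K * `|y - x|.
  move=> /andP[ax _] /andP[_ yb] xy.
  have [|c /andP[xc cy] ->] := @MVT_all f df x y xy.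
    by move=> z /andP[xz zy]; apply: hf; rewrite (le_trans ax)//= (le_trans zy).
  by rewrite normrM ler_wpM2r// hK// (le_trans ax)//= (le_trans cy).
move=> x y hx hy; have [xy|/ltW xy] := leP x y; last exact: key.
by rewrite distrC [`|x - y|]distrC; exact: key.
Qed.

Lemma antiderivative f (r : R) : 0 < r -> continuous f ->
  exists2 F : R -> R, F 0 = 0 & forall x, `|x| < r -> is_derive x 1 F (f x).
Proof.
move=> r0 cf.
(* Starting the integral at [- r] makes every point of the open interval, negative ones included,
   interior for the fundamental theorem; the value at [0] is subtracted afterwards. *)
pose G x := (\int[lebesgue_measure]_(t in `[(- r), x]) f t)%R.
exists (fun x => G x - G 0); first by rewrite subrr.
move=> x xr.
have [x1 x2] : - r < x /\ x < r by move: xr; rewrite ltr_norml => /andP.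
have int : lebesgue_measure.-integrable `[(- r), r] (EFin \o f).
  apply: continuous_compact_integrable; first exact: segment_compact.
  exact: continuous_subspaceT.
have [d1 d2] := @continuous_FTC1_closed R f (- r) x r x2 int x1 (cf x).
have dG : is_derive x 1 G (f x) by apply: DeriveDef; [exact: d1|rewrite -derive1E; exact: d2].
by rewrite -[f x]subr0; apply: is_deriveB.
Qed.

Lemma is_derive_shift f df x (c : R) : is_derive (x + c) 1 f df ->
  is_derive x 1 (fun z => f (z + c)) df.
Proof.
move=> h; have h1 : is_derive x 1 (fun z => z + c) 1 by apply: is_derive_eq; rewrite addr0.
by have := is_derive1_comp (g := fun z => z + c) h h1; rewrite mulr1.
Qed.

Lemma is_derive_fsum (I : finType) (f df : I -> R -> R) x :
  (forall i, is_derive x 1 (f i) (df i x)) ->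
  is_derive x 1 (fun z => \sum_i f i z) (\sum_i df i x).
Proof.
move=> h; elim: (index_enum I) => [|i s IH].
  rewrite big_nil (_ : (fun z => _) = cst 0); first exact: is_derive_cst.
  by apply/funext => z; rewrite big_nil.
rewrite big_cons (_ : (fun z => _) = f i + (fun z => \sum_(j <- s) f j z)).
  exact: is_deriveD.
by apply/funext => z; rewrite big_cons.
Qed.

(* The primitive is H(psi1)/psi1' - H(psi2)/psi2' with H' = f: integration by parts
   turns the C^2-closeness of psi1 and psi2 into smallness, whatever the modulus of
   continuity of f. *)
Lemma difference_almost_derivative (C M k w p q : R) (f : R -> R)
    (u du ddu v dv ddv : R -> R) : 0 < M -> 0 < k -> 0 <= w ->
  C = k + 2 * M * k ^+ 2 + 2 * M ^+ 2 * k ^+ 3 ->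
  continuous f -> (forall y, `|f y| <= 1) ->
  (forall x, p <= x <= q -> is_derive x 1 u (du x) /\ is_derive x 1 du (ddu x)) ->
  (forall x, p <= x <= q -> is_derive x 1 v (dv x) /\ is_derive x 1 dv (ddv x)) ->
  (forall x, p <= x <= q -> [/\ `|u x| <= M, k^-1 <= `|du x| & `|ddu x| <= M]) ->
  (forall x, p <= x <= q -> [/\ `|v x| <= M, k^-1 <= `|dv x| & `|ddv x| <= M]) ->
  (forall x, p <= x <= q ->
    [/\ `|u x - v x| <= w, `|du x - dv x| <= w & `|ddu x - ddv x| <= w]) ->
  exists P dP : R -> R, forall x, p <= x <= q ->
    [/\ is_derive x 1 P (dP x), `|P x| <= C * w &
        `|f (u x) - f (v x) - dP x| <= C * w].
Proof.
move=> M0 k0 w0 -> cf f1 du' dv' bu bv bw.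
(* With radius [M + 1] the primitive is differentiable on the closed interval from [- M] to [M];
   there [|f| <= 1] and [F 0 = 0] make it 1-Lipschitz and bounded by [M]. *)
have [F F0 dF] := @antiderivative f (M + 1) (ltr_wpDl (ltW M0) ltr01) cf.
have Mp y : `|y| <= M -> `|y| < M + 1 by move=> h; apply: le_lt_trans h _; rewrite ltrDl.
have lipF y z : `|y| <= M -> `|z| <= M -> `|F y - F z| <= `|y - z|.
  move=> hy hz; rewrite -[leRHS]mul1r.
  apply: (@lip_of_derive F f (- M) M 1) => [t|t||]; rewrite -?ler_norml//.
  by move=> ht; apply: dF; exact: Mp.
have FM y : `|y| <= M -> `|F y| <= M.
  move=> yM; apply: le_trans (yM); have := lipF y 0 yM.
  by rewrite normr0 F0 !subr0; apply; exact: ltW.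
(* The derivative of [F(u) / u'] is [f(u) - F(u) u'' / u'^2], so the error to bound is the
   difference of the terms [F u'' / u'^2] for [u] and [v], where [f] no longer occurs. *)
exists (fun x => F (u x) * (du x)^-1 - F (v x) * (dv x)^-1).
exists (fun x => f (u x) - F (u x) * ddu x * (du x) ^- 2 -
  (f (v x) - F (v x) * ddv x * (dv x) ^- 2)) => x xpq.
have [u1 u2 u3] := bu x xpq; have [v1 v2 v3] := bv x xpq.
have [w1 w2 w3] := bw x xpq.
have ki0 : 0 < k^-1 by rewrite invr_gt0.
have ud0 : du x != 0 by rewrite -normr_gt0; exact: lt_le_trans u2.
have vd0 : dv x != 0 by rewrite -normr_gt0; exact: lt_le_trans v2.
have part (g dg ddg : R -> R) : `|g x| <= M -> dg x != 0 ->
    is_derive x 1 g (dg x) /\ is_derive x 1 dg (ddg x) ->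
    is_derive x 1 (fun x => F (g x) * (dg x)^-1)
      (f (g x) - F (g x) * ddg x * (dg x) ^- 2).
  move=> g1 dg0 [d1 d2].
  have d3 : is_derive x 1 (F \o g) (f (g x) * dg x).
    by apply: is_derive1_comp d1; apply: dF; exact: Mp.
  have d4 := is_deriveV dg0 d2.
  have := is_deriveM d3 d4.
  have -> : (F \o g) x *: (- dg x ^- 2 *: ddg x) + (dg x)^-1 *: (f (g x) * dg x) =
    f (g x) - F (g x) * ddg x * (dg x) ^- 2.
    by rewrite /= /GRing.scale /=; field.
  by [].
have dP := is_deriveB (part u du ddu u1 ud0 (du' x xpq)) (part v dv ddv v1 vd0 (dv' x xpq)).
set r := (du x)^-1; set s := (dv x)^-1.
have rk : `|r| <= k by rewrite /r normfV -[k]invrK lef_pV2// posrE// normr_gt0.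
have sk : `|s| <= k by rewrite /s normfV -[k]invrK lef_pV2// posrE// normr_gt0.
have rs : `|r - s| <= w * k ^+ 2.
  have -> : r - s = (dv x - du x) * (r * s) by rewrite /r /s; field; rewrite ?ud0 ?vd0.
  rewrite !normrM distrC expr2.
  by apply: ler_pM => //; apply: ler_pM.
have F12 : `|F (u x) - F (v x)| <= w by apply: le_trans w1; exact: lipF.
have Fu := FM _ u1; have Fv := FM _ v1.
have bnd3 (z1 z2 z3 e1 e2 e3 : R) : `|z1| <= e1 -> `|z2| <= e2 -> `|z3| <= e3 ->
    `|z1 * z2 * z3| <= e1 * e2 * e3.
  by move=> *; rewrite !normrM; apply: ler_pM => //; rewrite ?mulr_ge0//; apply: ler_pM.
have k2 : `|r ^+ 2| <= k ^+ 2 by rewrite normrX lerXn2r// nnegrE// ltW.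
have rsD : `|r + s| <= 2 * k by apply: le_trans (ler_normD _ _) _; lra.
(* Both differences are telescoped one factor at a time. [T1] and [T2] give [k w + M k^2 w] for the
   primitive; [T3], [T4] and [T5] give [2 M k^2 w + 2 M^2 k^3 w] for the error. The constant [C]
   dominates both. *)
have T1 := bnd3 _ _ 1 _ _ 1 F12 rk (ltac:(by rewrite normr1)).
have T2 := bnd3 _ _ 1 _ _ 1 Fv rs (ltac:(by rewrite normr1)).
have T3 := bnd3 _ _ _ _ _ _ F12 u3 k2.
have T4 := bnd3 _ _ _ _ _ _ Fv w3 k2.
have T5 := bnd3 _ _ _ _ _ _ (bnd3 _ _ _ _ _ _ Fv v3 rs) rsD (_ : `|1| <= 1).
have k3 : 0 < k ^+ 2 by exact: exprn_gt0.
have k4 : 0 < k ^+ 3 by exact: exprn_gt0.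
have M2 : 0 < M ^+ 2 by exact: exprn_gt0.
have N1 : 0 <= M * k ^+ 2 * w by rewrite !mulr_ge0// ltW.
have N2 : 0 <= M ^+ 2 * k ^+ 3 * w by rewrite !mulr_ge0// ltW.
have N3 : 0 <= k * w by rewrite !mulr_ge0// ltW.
split => //.
- rewrite -/r -/s (_ : _ - _ = (F (u x) - F (v x)) * r * 1 + F (v x) * (r - s) * 1); last by ring.
  apply: le_trans (ler_normD _ _) _; move: T1 T2; lra.
- rewrite (_ : _ - _ - _ = (F (u x) - F (v x)) * ddu x * r ^+ 2 +
     F (v x) * (ddu x - ddv x) * r ^+ 2 + F (v x) * ddv x * (r - s) * (r + s) * 1); last first.
    by rewrite /r /s -!exprVn; ring.
  apply: le_trans (ler_normD _ _) _.
  apply: le_trans (lerD (ler_normD _ _) (lexx _)) _.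
  have := T5; rewrite normr1 => /(_ (lexx _)); move: T3 T4; lra.
Qed.

End Calculus.

(** * The arc x^4 + t^2 = 1 *)

Section Arc.
Context {R : realType}.
Implicit Types x y : R.

(** Upper branch of the curve. All estimates are made for [x] between [1/4] and [1/2], where [arc]
    and its second derivative both stay away from [0]. *)
Definition arc x : R := Num.sqrt (1 - x ^+ 4).
Definition darc x : R := - (2 * x ^+ 3 * (arc x)^-1).
Definition ddarc x : R := - (6 * x ^+ 2 * (arc x)^-1 + 4 * x ^+ 6 * (arc x)^-1 ^+ 3).

Lemma arc_eq x : 4^-1 <= x <= 2^-1 -> x ^+ 4 + arc x ^+ 2 = 1.
Proof.
move=> /andP[x1 x2]; have : x ^+ 4 <= 2^-1 ^+ 4 by rewrite lerXn2r// nnegrE; lra.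
by move=> h; rewrite sqr_sqrtr; lra.
Qed.

Lemma arc_bound x : 4^-1 <= x <= 2^-1 -> 15 / 16 <= arc x <= 1.
Proof.
move=> hx; have := arc_eq hx; move: hx => /andP[x1 x2].
have : 0 <= x ^+ 4 by rewrite exprn_ge0//; lra.
have : x ^+ 4 <= 2^-1 ^+ 4 by rewrite lerXn2r// nnegrE; lra.
have : 0 <= arc x by exact: sqrtr_ge0.
by move=> *; apply/andP; split; nra.
Qed.

Lemma is_derive_arc x : 4^-1 <= x <= 2^-1 -> is_derive x 1 arc (darc x).
Proof.
move=> hx; have /andP[h1 h2] := arc_bound hx.
have g0 : 0 < 1 - x ^+ 4 by have := arc_eq hx; nra.
have h3 : is_derive x 1 (fun z : R => 1 - z ^+ 4) (- (4 * x ^+ 3)).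
  by apply: is_derive_eq; rewrite /GRing.scale/=; ring.
have := is_derive1_comp (g := fun z : R => 1 - z ^+ 4) (is_derive1_sqrt g0) h3.
rewrite (_ : _ * _ = darc x)// /darc -/(arc x); field.
by rewrite gt_eqF//; lra.
Qed.

Lemma is_derive_arcV x : 4^-1 <= x <= 2^-1 ->
  is_derive x 1 (fun z => (arc z)^-1) (2 * x ^+ 3 * (arc x)^-1 ^+ 3).
Proof.
move=> hx; have /andP[h1 h2] := arc_bound hx.
have a0 : arc x != 0 by rewrite gt_eqF//; lra.
have := is_deriveV a0 (is_derive_arc hx).
rewrite (_ : _ *: _ = 2 * x ^+ 3 * (arc x)^-1 ^+ 3)//.
by rewrite /darc /GRing.scale/=; field.
Qed.

Lemma is_derive_darc x : 4^-1 <= x <= 2^-1 -> is_derive x 1 darc (ddarc x).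
Proof.
move=> hx; have h := is_derive_arcV hx.
rewrite /darc; apply: is_derive_eq.
by rewrite /ddarc /GRing.scale/=; ring.
Qed.

Lemma is_derive_ddarc x : 4^-1 <= x <= 2^-1 -> is_derive x 1 ddarc
  (- (12 * x * (arc x)^-1 + 36 * x ^+ 5 * (arc x)^-1 ^+ 3 + 24 * x ^+ 9 * (arc x)^-1 ^+ 5)).
Proof.
move=> hx; have h := is_derive_arcV hx.
rewrite /ddarc; apply: is_derive_eq.
by rewrite /GRing.scale/=; ring.
Qed.

Lemma arcV_bound x : 4^-1 <= x <= 2^-1 -> 1 <= (arc x)^-1 <= 16 / 15.
Proof.
move=> /arc_bound /andP[h1 h2]; have a0 : 0 < arc x by lra.
apply/andP; split; first by rewrite invf_ge1.
by rewrite -[16 / 15]invrK lef_pV2 ?posrE//; lra.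
Qed.

(** The derivatives of [arc] are combinations of such monomials, so this bound controls all of
    them. *)
Lemma mono_bound x (i j : nat) : 4^-1 <= x <= 2^-1 ->
  0 <= x ^+ i * (arc x)^-1 ^+ j <= 2^-1 ^+ i * (16 / 15) ^+ j.
Proof.
move=> hx; have /andP[h1 h2] := arcV_bound hx; move: hx => /andP[h3 h4].
apply/andP; split; first by rewrite mulr_ge0// exprn_ge0//; lra.
by apply: ler_pM; rewrite ?exprn_ge0 ?lerXn2r ?nnegrE//; lra.
Qed.

Lemma darc_bound x : 4^-1 <= x <= 2^-1 -> `|darc x| <= 8.
Proof.
move=> hx; have /andP[h1 h2] := mono_bound 3 1 hx.
rewrite /darc ler_norml; apply/andP; split; lra.
Qed.

Lemma ddarc_bound x : 4^-1 <= x <= 2^-1 -> `|ddarc x| <= 8 /\ 4^-1 <= - ddarc x.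
Proof.
move=> hx; have /andP[h1 h2] := mono_bound 2 1 hx.
have /andP[h3 h4] := mono_bound 6 3 hx.
have h5 : 4^-1 ^+ 2 <= x ^+ 2 * (arc x)^-1 ^+ 1.
  have /andP[h6 _] := arcV_bound hx; move: hx => /andP[h7 _].
  rewrite -[leLHS]mulr1; apply: ler_pM => //.
  by rewrite lerXn2r ?nnegrE//; lra.
rewrite /ddarc ler_norml; split; last by lra.
by apply/andP; split; lra.
Qed.

Lemma dddarc_bound x : 4^-1 <= x <= 2^-1 ->
  `|- (12 * x * (arc x)^-1 + 36 * x ^+ 5 * (arc x)^-1 ^+ 3 + 24 * x ^+ 9 * (arc x)^-1 ^+ 5)| <= 8.
Proof.
move=> hx; have /andP[h1 h2] := mono_bound 1 1 hx.
have /andP[h3 h4] := mono_bound 5 3 hx; have /andP[h5 h6] := mono_bound 9 5 hx.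
rewrite normrN ger0_norm; lra.
Qed.

Lemma arc_lip x y : 4^-1 <= x <= 2^-1 -> 4^-1 <= y <= 2^-1 ->
  [/\ `|arc x - arc y| <= 8 * `|x - y|, `|darc x - darc y| <= 8 * `|x - y| &
      `|ddarc x - ddarc y| <= 8 * `|x - y|].
Proof.
move=> hx hy; split.
- by apply: (lip_of_derive is_derive_arc darc_bound).
- by apply: (lip_of_derive is_derive_darc (fun z hz => (ddarc_bound hz).1)).
- exact: (lip_of_derive is_derive_ddarc dddarc_bound).
Qed.

(** Quantitative strict concavity: the second derivative is at most [-1/4]. This is what keeps the
    vertical displacement between two distinct arc points from being stationary. *)
Lemma darc_expand x y : 4^-1 <= x <= 2^-1 -> 4^-1 <= y <= 2^-1 ->
  4^-1 * `|x - y| <= `|darc x - darc y|.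
Proof.
have key x' y' : 4^-1 <= x' -> y' <= 2^-1 -> x' <= y' ->
    4^-1 * `|y' - x'| <= `|darc y' - darc x'|.
  move=> h1 h2 xy; have [|c /andP[c1 c2] ->] := @MVT_all R darc ddarc x' y' xy.
    by move=> z /andP[? ?]; apply: is_derive_darc; apply/andP; split; lra.
  rewrite normrM ler_wpM2r// -[`|ddarc c|]normrN; apply: le_trans (ler_norm _).
  by apply: (ddarc_bound _).2; apply/andP; split; lra.
move=> /andP[x1 x2] /andP[y1 y2]; have [xy|/ltW xy] := leP x y; last exact: key.
by rewrite distrC [`|darc _ - _|]distrC; exact: key.
Qed.

End Arc.

(** * Positive definite functions *)

Section PositiveDefinite.
Context {R : realType}.

(** Continuity is in the vertical variable, because the integration by parts is carried out in it
    with the horizontal variable frozen. *)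
Record correlation (F : R -> R -> R) : Prop := Correlation {
  corr_psd : forall (I : finType) (c x t : I -> R),
    0 <= \sum_i \sum_j c i * c j * F (x j - x i) (t j - t i);
  corr_even : forall a b, F (- a) (- b) = F a b;
  corr_unit : F 0 0 = 1;
  corr_nneg : forall a b, 0 <= F a b;
  corr_cont : forall a, continuous (F a) }.

Context {F : R -> R -> R} (hF : correlation F).

Lemma corr_le1 a b : F a b <= 1.
Proof.
have := corr_psd hF (fun i : bool => if i then 1 else - 1)
  (fun i : bool => if i then a else 0) (fun i : bool => if i then b else 0).
rewrite !big_bool/= !subrr (corr_unit hF) !sub0r (corr_even hF) !subr0.
by lra.
Qed.

(** In the form defined by [F] this is Cauchy-Schwarz against the unit vector at the origin:
    adjoining the origin with coefficient [- S] gives [Q - 2 S^2 + S^2 >= 0]. *)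
Lemma corr_cauchy_schwarz (I : finType) (c x t : I -> R) :
  (\sum_i c i * F (x i) (t i)) ^+ 2 <=
  \sum_i \sum_j c i * c j * F (x j - x i) (t j - t i).
Proof.
set S := (X in X ^+ 2); set Q := (X in _ <= X).
have := corr_psd hF (fun i : I + 'I_1 => if i is inl j then c j else - S)
  (fun i : I + 'I_1 => if i is inl j then x j else 0)
  (fun i : I + 'I_1 => if i is inl j then t j else 0).
rewrite big_sumType/= !big_ord1 [X in _ + X]big_sumType/= !big_ord1 !subrr (corr_unit hF).
rewrite (eq_bigr (fun i => \sum_j c i * c j * F (x j - x i) (t j - t i) +
    (- S) * (c i * F (x i) (t i)))) => [|i _]; last first.
  by rewrite big_sumType/= big_ord1 !sub0r (corr_even hF); congr (_ + _); ring.
rewrite big_split/= -mulr_sumr -/S -/Q.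
rewrite (eq_bigr (fun i => (- S) * (c i * F (x i) (t i)))) => [|i _]; last first.
  by rewrite !subr0; ring.
rewrite -mulr_sumr -/S expr2; lra.
Qed.

Lemma correlation_scale (r s : R) : correlation (fun a b => F (r * a) (s * b)).
Proof.
split=> [I c x t|a b||a b|a].
- have := corr_psd hF c (fun i => r * x i) (fun i => s * t i).
  by under eq_bigr do under eq_bigr do rewrite -!mulrBr.
- by rewrite !mulrN (corr_even hF).
- by rewrite !mulr0 (corr_unit hF).
- exact: (corr_nneg hF).
- move=> b; apply: (@continuous_comp _ _ _ (fun z => s * z) (F (r * a))).
    exact: mulrl_continuous.
  exact: (corr_cont hF).
Qed.

End PositiveDefinite.

(** * Vertical displacements between translated arc points *)

Section Arcs.
Context {R : realType}.

(** Vertical displacement between the arc points above [y + o] and [y + o'], corrected by [k]. Their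
    horizontal displacement does not depend on [y], so moving [y] moves only the second argument of
    [F]. *)
Definition psi (o o' k y : R) : R := arc (y + o') - arc (y + o) + k.
Definition dpsi (o o' y : R) : R := darc (y + o') - darc (y + o).
Definition ddpsi (o o' y : R) : R := ddarc (y + o') - ddarc (y + o).

Lemma is_derive_psi (o o' k y : R) : 4^-1 <= y + o <= 2^-1 -> 4^-1 <= y + o' <= 2^-1 ->
  is_derive y 1 (psi o o' k) (dpsi o o' y) /\ is_derive y 1 (dpsi o o') (ddpsi o o' y).
Proof.
move=> h h'; split.
  have d1 := is_derive_shift (is_derive_arc h); have d2 := is_derive_shift (is_derive_arc h').
  by rewrite /psi; apply: is_derive_eq; rewrite addr0.
have d1 := is_derive_shift (is_derive_darc h); have d2 := is_derive_shift (is_derive_darc h').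
exact: is_deriveB.
Qed.

(** The constant [C] of [difference_almost_derivative] for [M = 16] and [k = 4 / l]. *)
Definition psi_const (l : R) : R :=
  let k := 4 / l in k + 2 * 16 * k ^+ 2 + 2 * 16 ^+ 2 * k ^+ 3.

Lemma psi_const_ge0 l : 0 < l -> 0 <= psi_const l.
Proof.
move=> l0; rewrite /psi_const; set k := 4 / l.
have k0 : 0 <= k by rewrite divr_ge0// ltW.
by have := exprn_ge0 2 k0; have := exprn_ge0 3 k0; lra.
Qed.

(** The separation [l] forces a slope of at least [l / 4] by [darc_expand]. The closeness is
    [9 * eta]: [arc] and its first two derivatives are 8-Lipschitz, and [k1], [k2] differ by at most
    one more [eta]. *)
Lemma psi_difference (f : R -> R) (l eta p q o1 o2 o' k1 k2 : R) :
  0 < l -> 0 <= eta -> continuous f -> (forall y, `|f y| <= 1) ->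
  (forall y, p <= y <= q -> [/\ 4^-1 <= y + o1 <= 2^-1, 4^-1 <= y + o2 <= 2^-1 &
     4^-1 <= y + o' <= 2^-1]) ->
  `|o1 - o2| <= eta -> `|k1 - k2| <= eta -> `|k1| <= 1 -> `|k2| <= 1 ->
  l <= `|o' - o1| -> l <= `|o' - o2| ->
  exists P dP : R -> R, forall y, p <= y <= q ->
    [/\ is_derive y 1 P (dP y), `|P y| <= psi_const l * (9 * eta) &
        `|f (psi o1 o' k1 y) - f (psi o2 o' k2 y) - dP y| <= psi_const l * (9 * eta)].
Proof.
move=> l0 eta0 cf f1 hI ho hk hk1 hk2 hl1 hl2.
have bnd o k y : 4^-1 <= y + o <= 2^-1 -> 4^-1 <= y + o' <= 2^-1 -> `|k| <= 1 ->
    l <= `|o' - o| ->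
    [/\ `|psi o o' k y| <= 16, (4 / l)^-1 <= `|dpsi o o' y| & `|ddpsi o o' y| <= 16].
  move=> h h' /ler_normlP[hk3 hk4] hl.
  have /andP[? ?] := arc_bound h; have /andP[? ?] := arc_bound h'.
  have [/ler_normlP[? ?] _] := ddarc_bound h; have [/ler_normlP[? ?] _] := ddarc_bound h'.
  split.
  - by rewrite /psi ler_norml; apply/andP; split; lra.
  - apply: le_trans (darc_expand h' h).
    rewrite (_ : y + o' - (y + o) = o' - o); last by ring.
    by rewrite invf_div mulrC ler_wpM2l.
  - by rewrite /ddpsi ler_norml; apply/andP; split; lra.
have k0 : 0 < 4 / l by rewrite divr_gt0.
have w0 : 0 <= 9 * eta by rewrite mulr_ge0.
have M0 : 0 < 16 :> R by [].
apply: (difference_almost_derivative M0 k0 w0 (erefl (psi_const l)) cf f1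
  (du := dpsi o1 o') (ddu := ddpsi o1 o') (dv := dpsi o2 o') (ddv := ddpsi o2 o')).
- by move=> y /hI[h1 h2 h3]; exact: is_derive_psi.
- by move=> y /hI[h1 h2 h3]; exact: is_derive_psi.
- by move=> y /hI[h1 h2 h3]; exact: bnd.
- by move=> y /hI[h1 h2 h3]; exact: bnd.
move=> y /hI[h1 h2 h3]; have [L1 L2 L3] := arc_lip h1 h2.
have E : y + o1 - (y + o2) = o1 - o2 by ring.
rewrite E in L1 L2 L3; rewrite /psi /dpsi /ddpsi.
move: L1 L2 L3 hk => /ler_normlP[? ?] /ler_normlP[? ?] /ler_normlP[? ?] /ler_normlP[? ?].
by split; rewrite ler_norml; apply/andP; split; lra.
Qed.

End Arcs.

(** * Near-invariance of averages over the arc *)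

Section Smoothing.
Context {R : realType}.
Implicit Types (F : R -> R -> R) (a b y : R).

(** The [N] sample points span less than [1/16]. With [y] between [5/16] and [3/8] and perturbations
    of at most half a step, hence [1/32], everything stays between [1/4] and [1/2]. *)
Definition step (N : nat) : R := (16 * N%:R)^-1.

Definition smoothing_error (N : nat) (eta : R) : R := psi_const (step N / 2) * (9 * eta).

(* The squared norm of the difference of the two translates of the averaged arc, expanded
   by positive definiteness, is a derivative up to a small error and a diagonal term. *)
Lemma shifted_average_le F (N : nat) (eta a b : R) : correlation F ->
  (forall x t, x ^+ 4 + t ^+ 2 = 1 -> F x t = 0) -> (0 < N)%N ->
  0 <= eta -> eta <= step N / 2 -> `|a| <= eta -> `|b| <= eta ->
  exists G dG : R -> R, forall y, 5 / 16 <= y <= 3 / 8 ->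
    [/\ is_derive y 1 G (dG y), `|G y| <= 2 * smoothing_error N eta &
      (N%:R^-1 * \sum_(m < N) F (y + m%:R * step N - a) (arc (y + m%:R * step N) - b)) ^+ 2
        <= dG y + 2 * smoothing_error N eta + 2 / N%:R].
Proof.
move=> hF F0 N0 eta0 etaN ha hb.
set h := step N in etaN *; set om := smoothing_error N eta.
have N1 : 1 <= N%:R :> R by rewrite ler1n.
have NR0 : 0 < N%:R :> R by rewrite ltr0n.
have Nh : 16 * N%:R * h = 1 by rewrite /h /step divff// gt_eqF// mulr_gt0.
have h0 : 0 < h by rewrite /h /step invr_gt0 mulr_gt0.
have h1 : h <= 16^-1 by rewrite /h /step lef_pV2 ?posrE ?mulr_gt0//; lra.
have om0 : 0 <= om.
  by rewrite mulr_ge0 ?mulr_ge0// psi_const_ge0// divr_gt0.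
have [a1 a2] : - eta <= a /\ a <= eta by move: ha; rewrite ler_norml => /andP.
have [b1 b2] : - eta <= b /\ b <= eta by move: hb; rewrite ler_norml => /andP.
pose c (m : 'I_N) := m%:R * h.
have cb m : 0 <= c m <= 16^-1.
  rewrite /c mulr_ge0 ?(ltW h0)//=; have : m%:R <= N%:R :> R by rewrite ler_nat ltnW.
  by move=> /(ler_wpM2r (ltW h0)); lra.
(* The boolean tags two families over the same abscissae [y - a + c m]: [true] for the arc point
   over [y + c m] translated by [(- a, - b)], [false] for the arc point lying over that abscissa. *)
pose d (al : bool) := if al then 0 else - a; pose e (al : bool) := if al then b else 0.
have db al : - eta <= d al <= eta by case: al; apply/andP; split; rewrite /d/=; lra.
have eb al : - eta <= e al <= eta by case: al; apply/andP; split; rewrite /e/=; lra.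
pose K (m m' : 'I_N) al be y := F (c m' - c m) (psi (c m + d al) (c m' + d be) (e al - e be) y).
(* Within each bracket only the tag of [m] changes, so [psi_difference] applies to it with nearby
   offsets. *)
pose T m m' y := K m m' false false y - K m m' true false y - (K m m' false true y - K m m' true true y).
have hI m al y : 5 / 16 <= y <= 3 / 8 -> 4^-1 <= y + (c m + d al) <= 2^-1.
  move=> /andP[y1 y2]; have /andP[? ?] := cb m; have /andP[? ?] := db al.
  by apply/andP; split; lra.
have sep m m' al be : m != m' -> h / 2 <= `|c m' + d be - (c m + d al)|.
  move=> mm; have : h <= `|c m' - c m|.
    rewrite /c -mulrBl normrM (gtr0_norm h0) -{1}[h]mul1r ler_pM2r//.
    have [lt|] := ltnP m m'.
      by rewrite -natrB ?(ltnW lt)// normr_nat ler1n subn_gt0.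
    rewrite leq_eqVlt eq_sym (inj_eq val_inj) (negPf mm)/= => lt.
    by rewrite distrC -natrB ?(ltnW lt)// normr_nat ler1n subn_gt0.
  have -> : c m' + d be - (c m + d al) = c m' - c m - (d al - d be) by ring.
  move=> hc; apply: le_trans (lerB_dist _ _).
  have : `|d al - d be| <= eta by case: al; case: be; rewrite /d/= ler_norml; apply/andP; split; lra.
  by lra.
have exP (i : 'I_N * 'I_N) : exists P : (R -> R) * (R -> R), forall y, 5 / 16 <= y <= 3 / 8 ->
    [/\ is_derive y 1 P.1 (P.2 y), `|P.1 y| <= 2 * om &
        T i.1 i.2 y <= P.2 y + 2 * om + (i.1 == i.2)%:R * 2].
  case: i => m m' /=; have [<-|mm] := eqVneq m m'.
    (* On the diagonal the displacement is not separated and no cancellation is sought: the two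
       equal-tag terms are [1] and the mixed ones are subtracted, whence the bound [2]. *)
    exists (fun=> 0, fun=> 0) => y _ /=; split.
    - exact: is_derive_cst.
    - by rewrite normr0 mulr_ge0.
    - have Kd al : K m m al al y = 1.
        by rewrite /K /psi !subrr addr0 (corr_unit hF).
      rewrite /T !Kd mul1r.
      by have := corr_nneg hF; move=> F00; have := F00 (c m - c m) (psi (c m + d true) (c m + d false) (e true - e false) y); have := F00 (c m - c m) (psi (c m + d false) (c m + d true) (e false - e true) y); rewrite /K; lra.
  have ex be : exists P dP : R -> R, forall y, 5 / 16 <= y <= 3 / 8 ->
      [/\ is_derive y 1 P (dP y), `|P y| <= om & `|K m m' false be y - K m m' true be y - dP y| <= om].
    have l0 : 0 < h / 2 by rewrite divr_gt0.
    apply: (psi_difference (p := 5 / 16) (q := 3 / 8) (o1 := c m + d false)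
      (o2 := c m + d true) (o' := c m' + d be) (k1 := e false - e be)
      (k2 := e true - e be) l0 eta0 (@corr_cont _ _ hF (c m' - c m))).
    - by move=> y; rewrite ger0_norm ?(corr_nneg hF)// (corr_le1 hF).
    - by move=> y hy; split; exact: hI.
    - by rewrite /d ler_norml; apply/andP; split; lra.
    - by rewrite /e ler_norml; case: be; apply/andP; split; lra.
    - by rewrite /e ler_norml; case: be; apply/andP; split; lra.
    - by rewrite /e ler_norml; case: be; apply/andP; split; lra.
    - exact: sep.
    - exact: sep.
  have [P1 [dP1 hP1]] := ex false; have [P2 [dP2 hP2]] := ex true.
  exists (fun y => P1 y - P2 y, fun y => dP1 y - dP2 y) => y hy /=.
  have [d1 p1 t1] := hP1 y hy; have [d2 p2 t2] := hP2 y hy.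
  split; first exact: is_deriveB.
    by apply: le_trans (ler_normB _ _) _; lra.
  by move: t1 t2; rewrite /T !ler_norml => /andP[? ?] /andP[? ?]; lra.
have [P hP] := choice exP.
exists (fun y => N%:R ^- 2 * \sum_i (P i).1 y).
exists (fun y => N%:R ^- 2 * \sum_i (P i).2 y) => y hy.
have cardP : \sum_(i : 'I_N * 'I_N) (2 * om) = N%:R ^+ 2 * (2 * om).
  by rewrite sumr_const card_prod card_ord -[LHS]mulr_natl natrM expr2.
split.
- apply: is_deriveZ; apply: (is_derive_fsum (df := fun i => (P i).2)) => i.
  by have [] := hP i y hy.
- rewrite normrM normfV normrX normr_nat mulrC ler_pdivrMr ?exprn_gt0// mulrC -cardP.
  by apply: le_trans (ler_norm_sum _ _ _) _; apply: ler_sum => i _; have [] := hP i y hy.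
apply: (@le_trans _ _ (N%:R ^- 2 * \sum_(i : 'I_N * 'I_N) T i.1 i.2 y)).
  pose t m al := arc (y + (c m + d al)) - e al.
  have EK m m' al be : F (y - a + c m' - (y - a + c m)) (t m' be - t m al) = K m m' al be y.
    by rewrite /K; congr (F _ _); [ring|rewrite /psi /t; ring].
  (* Weights [1/N] on the translated points and [- 1/N] on the arc points: since [F] vanishes on the
     arc, the linear side is just the wanted average. *)
  have := corr_cauchy_schwarz hF
    (fun i : 'I_N + 'I_N => if i is inl _ then N%:R^-1 else - N%:R^-1)
    (fun i => match i with inl m | inr m => y - a + c m end)
    (fun i => match i with inl m => t m true | inr m => t m false end).
  rewrite [X in X ^+ 2]big_sumType /=.
  rewrite [X in (_ + X) ^+ 2]big1 ?addr0 => [|m _]; last first.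
    rewrite (_ : y - a + c m = y + (c m + d false)) ?F0 ?mulr0//; last by rewrite /d; ring.
    by rewrite /t /e subr0 arc_eq// hI.
  rewrite -mulr_sumr.
  have -> : \sum_m F (y - a + c m) (t m true) =
      \sum_(m < N) F (y + m%:R * h - a) (arc (y + m%:R * h) - b).
    by apply: eq_bigr => m _; congr (F _ _); [rewrite /c; ring|rewrite /t /d /e addr0].
  move=> /le_trans; apply; rewrite le_eqVlt; apply/orP; left; apply/eqP.
  rewrite -(pair_bigA _ (fun m m' => T m m' y)) /= mulr_sumr big_sumType/= -big_split/=.
  apply: eq_bigr => m _; rewrite !big_sumType/= mulr_sumr -!big_split/=.
  apply: eq_bigr => m' _; rewrite !EK /T -exprVn; ring.
have sumT : \sum_(i : 'I_N * 'I_N) T i.1 i.2 y <=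
    \sum_i (P i).2 y + N%:R ^+ 2 * (2 * om) + N%:R * 2.
  have diag : \sum_(i : 'I_N * 'I_N) (i.1 == i.2)%:R * 2 = N%:R * 2 :> R.
    rewrite -(pair_bigA _ (fun m m' : 'I_N => (m == m')%:R * 2)) /=.
    rewrite (eq_bigr (fun=> 2)) => [|m _]; first by rewrite sumr_const card_ord -[LHS]mulr_natl.
    rewrite (bigD1 m)//= eqxx mul1r big1 ?addr0// => m' /negPf.
    by rewrite eq_sym => ->; rewrite mul0r.
  rewrite -diag -cardP -!big_split/=; apply: ler_sum => i _.
  by have [_ _ ] := hP i y hy.
apply: le_trans (ler_wpM2l _ sumT) _; first by rewrite invr_ge0 exprn_ge0.
rewrite le_eqVlt; apply/orP; left; apply/eqP; field.
by rewrite gt_eqF.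
Qed.

(** One value of [y] has to serve all [u] at once, so the bounds of [shifted_average_le] are summed
    over [u] before the mean value theorem selects [y]. [N] and [eta] do not depend on the number of
    points [u]. *)
Lemma equidistribution (eps : R) : 0 < eps -> exists N eta, [/\ (0 < N)%N, 0 < eta &
  forall F, correlation F -> (forall x t, x ^+ 4 + t ^+ 2 = 1 -> F x t = 0) ->
  forall (U : finType) (a b : U -> R), (forall u, `|a u| <= eta /\ `|b u| <= eta) ->
  exists x t : 'I_N -> R, (forall m, x m ^+ 4 + t m ^+ 2 = 1) /\
    \sum_u \sum_m F (x m - a u) (t m - b u) <= eps * #|U|%:R * N%:R].
Proof.
(* Makes the diagonal contribution [2 / N] at most [eps^2 / 2]. *)
move=> e0; pose N := (Num.truncn (4 / eps ^+ 2)).+1.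
have e20 : 0 < eps ^+ 2 by exact: exprn_gt0.
have hN : 4 / eps ^+ 2 < N%:R by exact: truncnS_gt.
have NR0 : 0 < N%:R :> R by rewrite ltr0n.
have l0 : 0 < step N / 2 by rewrite divr_gt0// invr_gt0 mulr_gt0.
have K0 := psi_const_ge0 l0; set K := psi_const (step N / 2) in K0.
(* The smoothing error enters [66] times: [64] through the mean value theorem, which divides a
   variation of at most [4] errors by the length [1/16], and [2] directly. *)
pose eta := Num.min (step N / 2) (eps ^+ 2 / (2 * 66 * 9 * (K + 1))).
have K1 : 0 < K + 1 by lra.
have eta0 : 0 < eta by rewrite lt_min l0 divr_gt0// !mulr_gt0.
have etaN : eta <= step N / 2 by rewrite ge_min lexx.
have om : 66 * smoothing_error N eta <= eps ^+ 2 / 2.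
  have : eta <= eps ^+ 2 / (2 * 66 * 9 * (K + 1)) by rewrite ge_min lexx orbT.
  rewrite ler_pdivlMr ?mulr_gt0// => h; rewrite /smoothing_error -/K.
  have : 0 <= eta * K by rewrite mulr_ge0// ltW.
  by nra.
have om0 : 0 <= smoothing_error N eta by rewrite /smoothing_error !mulr_ge0// ltW.
exists N, eta; split => // F hF F0 U a b hab.
have /choice[G hG] (u : U) : exists G : (R -> R) * (R -> R),
    forall y, 5 / 16 <= y <= 3 / 8 ->
    [/\ is_derive y 1 G.1 (G.2 y), `|G.1 y| <= 2 * smoothing_error N eta &
      (N%:R^-1 * \sum_(m < N) F (y + m%:R * step N - a u) (arc (y + m%:R * step N) - b u)) ^+ 2
        <= G.2 y + 2 * smoothing_error N eta + 2 / N%:R].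
  have [ha hb] := hab u.
  have [G [dG h]] := shifted_average_le hF F0 (ltn0Sn _) (ltW eta0) etaN ha hb.
  by exists (G, dG).
have [| |y /andP[y1 y2] Ey] := @MVT_all R (fun y => \sum_u (G u).1 y) (fun y => \sum_u (G u).2 y)
    (5 / 16) (3 / 8).
- by lra.
- move=> y hy; apply: (is_derive_fsum (df := fun u => (G u).2)) => u.
  by have [] := hG u y hy.
have hy : 5 / 16 <= y <= 3 / 8 by rewrite y1.
exists (fun m : 'I_N => y + m%:R * step N), (fun m : 'I_N => arc (y + m%:R * step N)).
have Nh : 16 * N%:R * step N = 1 by rewrite /step divff// gt_eqF// mulr_gt0.
split=> [m|].
  apply: arc_eq; have mN : m%:R <= N%:R :> R by rewrite ler_nat ltnW.
  have s0 : 0 < step N by rewrite invr_gt0 mulr_gt0.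
  have := ler_wpM2r (ltW s0) mN; have : 0 <= m%:R * step N by rewrite mulr_ge0// ltW.
  by move=> *; apply/andP; split; lra.
pose z u := N%:R^-1 * \sum_(m < N) F (y + m%:R * step N - a u) (arc (y + m%:R * step N) - b u).
have cU (r : R) : \sum_(u : U) r = #|U|%:R * r by rewrite sumr_const -[LHS]mulr_natl.
have sumG x : 5 / 16 <= x <= 3 / 8 ->
    `|\sum_u (G u).1 x| <= #|U|%:R * (2 * smoothing_error N eta).
  move=> hx; rewrite -cU; apply: le_trans (ler_norm_sum _ _ _) _; apply: ler_sum => u _.
  by have [] := hG u x hx.
have U0 : 0 <= #|U|%:R :> R by [].
have dsum : \sum_u (G u).2 y <= #|U|%:R * (64 * smoothing_error N eta).
  have := sumG (3 / 8) (ltac:(apply/andP; split; lra)).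
  have := sumG (5 / 16) (ltac:(apply/andP; split; lra)).
  move: Ey; rewrite !ler_norml => Ey /andP[h1 h2] /andP[h3 h4]; lra.
have z2 : \sum_u z u ^+ 2 <= #|U|%:R * eps ^+ 2.
  apply: (@le_trans _ _ (\sum_u ((G u).2 y + 2 * smoothing_error N eta + 2 / N%:R))).
    by apply: ler_sum => u _; have [] := hG u y hy.
  rewrite !big_split/= !cU.
  have : 2 / N%:R <= eps ^+ 2 / 2.
    by move: hN; rewrite ltr_pdivrMr// ler_pdivrMr//; lra.
  move=> /(ler_wpM2l U0); have := ler_wpM2l U0 om; lra.
have zz : \sum_u z u <= #|U|%:R * eps.
  (* Passage from mean squares to means, by expanding [(z u - eps)^2 >= 0]. *)
  have zle u : z u <= z u ^+ 2 * (2 * eps)^-1 + eps / 2.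
    have : 0 <= (z u - eps) ^+ 2 * (2 * eps)^-1 by rewrite mulr_ge0 ?sqr_ge0// invr_ge0 ltW// mulr_gt0.
    by rewrite (_ : _ * _ = z u ^+ 2 * (2 * eps)^-1 - z u + eps / 2); [lra|field; rewrite gt_eqF].
  apply: le_trans (ler_sum _ (fun u _ => zle u)) _.
  rewrite big_split/= cU -mulr_suml.
  have ei : 0 <= (2 * eps)^-1 by rewrite invr_ge0 ltW// mulr_gt0.
  have := ler_wpM2r ei z2.
  by rewrite (_ : _ * eps ^+ 2 * _ = #|U|%:R * (eps / 2)); [lra|field; rewrite gt_eqF].
rewrite [eps * _]mulrC -ler_pdivrMr//; apply: le_trans zz.
by rewrite mulr_suml; apply: ler_sum => u _; rewrite /z mulrC.
Qed.

End Smoothing.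

(** * Sparse sequences of radii *)

Section SparseRadii.
Context {R : realType}.

Lemma sqr_sum_bound (x t r : R) : 0 < r -> x ^+ 4 + t ^+ 2 = r ^+ 4 ->
  `|x| <= r /\ `|t| <= r ^+ 2.
Proof.
move=> r0 h; have r20 : 0 < r ^+ 2 by exact: exprn_gt0.
have h4 (z : R) : z ^+ 4 = z ^+ 2 ^+ 2 by rewrite -exprM.
have x20 := sqr_ge0 x; have t20 := sqr_ge0 t; have x40 := sqr_ge0 (x ^+ 2).
rewrite -h4 in x40; split.
  rewrite -ler_sqr ?nnegrE ?(ltW r0)// real_normK ?num_real//.
  by rewrite -ler_sqr ?nnegrE ?(ltW r20)// -!h4; lra.
by rewrite -ler_sqr ?nnegrE ?(ltW r20)// real_normK ?num_real// -h4; lra.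
Qed.

(** Families of [N] points are chosen one curve after another, each nearly orthogonal to all earlier
    ones. The form evaluated on their union is at most [(k + eps * k^2) N^2], against the lower
    bound [delta * k^2 N^2]; with [eps = delta / 2] and [k > 2 / delta] these are incompatible. *)
Lemma no_sparse_zero_curves (delta : R) : 0 < delta -> exists k eta,
  [/\ 0 < eta, eta <= 1 & forall (r : nat -> R) (L : R) (F : R -> R -> R),
    (forall j, 0 < r j) -> (forall i j, (i < j)%N -> r i <= eta * r j) ->
    (forall j, (j < k)%N -> r j <= L) -> correlation F ->
    (forall j x t, (j < k)%N -> x ^+ 4 + t ^+ 2 = r j ^+ 4 -> F x t = 0) ->
    ~ (forall (I : finType) (x t : I -> R), (forall i, x i ^+ 4 + t i ^+ 2 <= L ^+ 4) ->
        delta * #|I|%:R ^+ 2 <= \sum_i \sum_j F (x j - x i) (t j - t i))].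
Proof.
move=> d0; pose eps := delta / 2; have e0 : 0 < eps by rewrite divr_gt0.
have [N [eta0 [N0 eta00 equi]]] := equidistribution e0.
pose k := (Num.truncn (2 / delta)).+1; pose eta := Num.min eta0 1.
have hk : 2 / delta < k%:R by exact: truncnS_gt.
have eta_gt0 : 0 < eta by rewrite lt_min eta00/=.
have eta1 : eta <= 1 by rewrite ge_min lexx orbT.
have etale : eta <= eta0 by rewrite ge_min lexx.
have NR0 : 0 < N%:R :> R by rewrite ltr0n.
exists k, eta; split => // r L F r0 rr rL hF F0 hd.
pose E (X T : nat -> 'I_N -> R) i i' :=
  \sum_m \sum_m' F (X i' m' - X i m) (T i' m' - T i m).
have step j : (j <= k)%N -> exists X T : nat -> 'I_N -> R,
    (forall i m, (i < j)%N -> X i m ^+ 4 + T i m ^+ 2 = r i ^+ 4) /\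
    \sum_(i < j) \sum_(i' < j) E X T i i' <= (j%:R + eps * j%:R ^+ 2) * N%:R ^+ 2.
  elim: j => [_|j IH jk].
    exists (fun _ _ => 0), (fun _ _ => 0); split => //.
    by rewrite big_ord0 expr0n mulr0 addr0 mul0r.
  have [X [T [hXT hE]]] := IH (ltnW jk).
  have rj := r0 j; have rj2 : 0 < r j ^+ 2 by exact: exprn_gt0.
  (* The parabolic rescaling brings the curve of radius [r j] to radius [1]; the earlier points, on
     much smaller curves, then have coordinates at most [eta]. *)
  have [||x [t [hxt hsum]]] := equi (fun a b => F (r j * a) (r j ^+ 2 * b))
      (correlation_scale hF (r j) (r j ^+ 2)) _ ('I_j * 'I_N)%type
      (fun u => X u.1 u.2 / r j) (fun u => T u.1 u.2 / r j ^+ 2).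
  - move=> x t h; apply: (F0 j) => //.
    by rewrite (_ : _ + _ = r j ^+ 4 * (x ^+ 4 + t ^+ 2)); [rewrite h mulr1|ring].
  - move=> [i m] /=; have [h1 h2] := sqr_sum_bound (r0 i) (hXT i m (ltn_ord i)).
    have h3 := rr _ _ (ltn_ord i); split.
      rewrite normrM normfV (gtr0_norm rj) ler_pdivrMr//.
      by apply: le_trans h1 (le_trans h3 _); rewrite ler_pM2r.
    rewrite normrM normfV (gtr0_norm rj2) ler_pdivrMr//.
    (* The rescaled height is at most [eta^2], which is at most [eta] because [eta <= 1]. *)
    apply: le_trans h2 _; apply: (@le_trans _ _ ((eta * r j) ^+ 2)).
      by rewrite ler_sqr ?nnegrE ?mulr_ge0// ltW.
    rewrite exprMn ler_pM2r//; apply: le_trans etale.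
    by rewrite expr2 -[leRHS]mulr1 ler_pM2l.
  pose X' i := if i == j then fun m => r j * x m else X i.
  pose T' i := if i == j then fun m => r j ^+ 2 * t m else T i.
  exists X', T'; split.
    move=> i m; rewrite ltnS leq_eqVlt /X' /T'; case: eqP => [->|_] /= lt; last exact: hXT.
    by rewrite (_ : _ + _ = r j ^+ 4 * (x m ^+ 4 + t m ^+ 2)); [rewrite hxt mulr1|ring].
  have Eold (i i' : 'I_j) : E X' T' i i' = E X T i i'.
    by rewrite /E /X' /T' !ltn_eqF.
  have Esym i i' : E X' T' i i' = E X' T' i' i.
    rewrite /E exchange_big/=; apply: eq_bigr => m _; apply: eq_bigr => m' _.
    by rewrite -(corr_even hF) !opprB.
  have Enew : \sum_(i < j) E X' T' i j <= eps * j%:R * N%:R ^+ 2.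
    apply: (@le_trans _ _ (eps * (j%:R * N%:R) * N%:R)); last by rewrite expr2 !mulrA.
    rewrite -natrM; move: hsum; rewrite card_prod !card_ord; apply: le_trans.
    rewrite -(pair_bigA _ (fun (i : 'I_j) (m : 'I_N) => \sum_(m' < N) F (r j * (x m' - X i m / r j))
       (r j ^+ 2 * (t m' - T i m / r j ^+ 2)))) /=.
    apply: ler_sum => i _; apply: ler_sum => m _; apply: ler_sum => m' _.
    have E1 (z w c : R) : 0 < c -> c * (z - w / c) = c * z - w.
      by move=> c0; field; rewrite gt_eqF.
    by rewrite /X' /T' eqxx !ltn_eqF// !E1.
  have Ejj : E X' T' j j <= N%:R ^+ 2.
    have -> : N%:R ^+ 2 = \sum_(m < N) \sum_(m' < N) 1 :> R.
      by rewrite !sumr_const card_ord -mulrnA -natrX.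
    by apply: ler_sum => m _; apply: ler_sum => m' _; exact: (corr_le1 hF).
  have -> : \sum_(i < j.+1) \sum_(i' < j.+1) E X' T' i i' =
      \sum_(i < j) \sum_(i' < j) E X T i i' + \sum_(i < j) E X' T' i j +
      (\sum_(i < j) E X' T' i j + E X' T' j j).
    rewrite big_ord_recr/=; congr (_ + _).
      rewrite -big_split/=; apply: eq_bigr => i _; rewrite big_ord_recr/=; congr (_ + _).
      by apply: eq_bigr => i' _; exact: Eold.
    by rewrite big_ord_recr/=; congr (_ + _); apply: eq_bigr => i _; exact: Esym.
  (* The new block contributes at most [2 eps j + 1] in units of [N^2], within the increment from
     [j + eps j^2] to its value at [j + 1]. *)
  rewrite -natr1; move: hE Enew Ejj.
  have : 0 < N%:R ^+ 2 :> R by exact: exprn_gt0.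
  have : 0 < eps * N%:R ^+ 2 by rewrite mulr_gt0// exprn_gt0.
  lra.
have [X [T [hXT hE]]] := step k (leqnn _).
have := hd ('I_k * 'I_N)%type (fun u => X u.1 u.2) (fun u => T u.1 u.2).
rewrite card_prod !card_ord => h.
have {h} : delta * (k * N)%:R ^+ 2 <= \sum_(i < k) \sum_(i' < k) E X T i i'.
  apply: le_trans (h _) _ => [[i m]/=|].
    by rewrite hXT// lerXn2r ?nnegrE ?rL// ltW// (lt_le_trans (r0 i))// rL.
  rewrite -(pair_bigA _ (fun (i : 'I_k) (m : 'I_N) => \sum_(u : 'I_k * 'I_N) F (X u.1 u.2 - X i m) (T u.1 u.2 - T i m))) /=.
  apply: ler_sum => i _; rewrite /E [leRHS]exchange_big/=; apply: ler_sum => m _.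
  by rewrite -(pair_bigA _ (fun (i' : 'I_k) (m' : 'I_N) => F (X i' m' - X i m) (T i' m' - T i m))) /=.
move=> h; have {h hE} := le_trans h hE.
rewrite natrM exprMn mulrA ler_pM2r ?exprn_gt0//.
move: hk; rewrite ltr_pdivrMr// => hk.
have k0 : 0 < k%:R :> R by rewrite ltr0n.
rewrite /eps; nra.
Qed.

End SparseRadii.

(** * Using the density hypothesis, and the conclusion *)

Section Main.
Context {R : realType} {n : nat}.
Local Notation H := (heis R n).

Lemma upper_density_witness (A : set H) : (0 < upper_density A)%E ->
  exists2 d : R, 0 < d & forall M : R, exists r x, M < r /\
    d * vol (kball x r) < vol (A `&` kball x r).
Proof.
move=> hA.
have [d d0 dA] : exists2 d : R, 0 < d & (d%:E < upper_density A)%E.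
  move: hA; case: (upper_density A) => [s| |]// h.
    by exists (s / 2); rewrite ?lte_fin in h *; lra.
  by exists 1; rewrite ?ltey.
exists d => // M.
have : (d%:E < ereal_sup (sup_density A @` [set r : R | (M < r)%R]))%E.
  apply: (lt_le_trans dA); apply: ereal_inf_lbound.
  exists [set r : R | (M < r)%R] => //; exists M; split => //; exact: num_real.
move=> /ereal_sup_gt[_ [r /= Mr <-]] /ereal_sup_gt[_ [x _ <-]].
rewrite lte_fin => h; exists r, x; split => //.
have V0 : 0 <= vol (kball x r) by exact: vol_ge0.
move: V0; rewrite le_eqVlt => /orP[/eqP V0|V0]; last by rewrite -ltr_pdivlMr.
(* A ball of volume [0] would give the quotient its default value [0], which is not above [d]. *)
by move: h; rewrite -/(vol _) -/(vol _) -V0 invr0 mulr0 ltNge ltW.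
Qed.

Lemma corr_correlation (j0 : 'I_n) (A : set H) : leb_measurable A ->
  (leb_outer A < +oo)%E -> 0 < vol A -> correlation (fun a b => corr j0 A a b / vol A).
Proof.
move=> mA fA v0; have vi : 0 < (vol A)^-1 by rewrite invr_gt0.
split=> [I c x t|a b||a b|a].
- have h := corr_pd j0 mA fA c x t.
  have -> : \sum_i \sum_j c i * c j * (corr j0 A (x j - x i) (t j - t i) / vol A) =
      (\sum_i \sum_j c i * c j * corr j0 A (x j - x i) (t j - t i)) / vol A.
    by rewrite mulr_suml; apply: eq_bigr => i _; rewrite mulr_suml;
      apply: eq_bigr => j _; rewrite mulrA.
  by rewrite divr_ge0// ltW.
- by rewrite corrN.
- by rewrite corr0 divff// gt_eqF.
- by rewrite divr_ge0// ?corr_ge0// ltW.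
move=> b; apply/cvgrPdist_le => /= e e0.
have e1 : 0 < e * vol A by rewrite mulr_gt0.
have [d d0 hd] := corr_vertical j0 mA fA e1.
near=> b'.
rewrite -mulrBl normrM (gtr0_norm vi) ler_pdivrMr//; apply: hd.
near: b'; have := nbhsx_ballx b d d0.
by apply: filterS => z; rewrite /ball/= distrC => /ltW.
Unshelve. all: by end_near.
Qed.

End Main.

Theorem theorem1p1 (R : realType) (n : nat) (hn : (1 <= n)%N)
  (A : set (heis R n)) (hA : leb_measurable A)
  (hdens : (0 < upper_density A)%E) :
  exists R0 : R, 0 < R0 /\
    forall r : R, R0 <= r -> exists x y : heis R n, A x /\ A y /\ dK x y = r.
Proof.
apply: contrapT => neg.
have /choice[g hg] (M : R) : exists r, 0 < M ->
    M <= r /\ forall x y, A x -> A y -> dK x y <> r.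
  have [M0|M0] := ltP 0 M; last by exists 0.
  apply: contrapT => hM; apply: neg; exists M; split => // r Mr.
  apply: contrapT => hr; apply: hM; exists r => _; split => // x y Ax Ay xyr.
  by apply: hr; exists x, y.
have [d0 d00 dens] := upper_density_witness hdens.
pose Q : R := 3 ^+ (n + n + 2); have Q0 : 0 < Q by exact: exprn_gt0.
(* The density is divided by [Q] because translates of the localised set only fit in a ball of three
   times the radius. *)
have [k [eta [eta0 eta1 sparse]]] := @no_sparse_zero_curves R (d0 / Q) (divr_gt0 d00 Q0).
(* Radii that are not distances in [A], each at least [1 / eta] times the preceding one. *)
pose r := fix r (j : nat) : R := if j is j'.+1 then g (r j' / eta) else g 1.
have rpos j : 0 < r j.
  elim: j => [|j IH] /=; first by have [/(lt_le_trans ltr01)] := hg 1 ltr01.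
  have h : 0 < r j / eta by rewrite divr_gt0.
  by have [/(lt_le_trans h)] := hg _ h.
have rbad j x y : A x -> A y -> dK x y <> r j.
  case: j => [|j] /=; first by have [_] := hg 1 ltr01; apply.
  by have [_] := hg (r j / eta) (divr_gt0 (rpos j) eta0); apply.
have rS j : r j <= eta * r j.+1.
  have [h _] := hg (r j / eta) (divr_gt0 (rpos j) eta0).
  by rewrite mulrC -ler_pdivrMr.
have rlt i j : (i < j)%N -> r i <= eta * r j.
  elim: j => // j IH; rewrite ltnS leq_eqVlt => /orP[/eqP->//|/IH h].
  apply: (le_trans h); apply: (@le_trans _ _ (r j)) => //.
  by rewrite -[leRHS]mul1r ler_pM2r.
have rL j : (j < k)%N -> r j <= r k.
  by move=> /rlt /le_trans; apply; rewrite -[leRHS]mul1r ler_pM2r.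
(* The localising ball is taken larger than all the radii in play, so that shifts of size at most
   [r k] keep the set within radius [3 * rho]. *)
have [rho [x [rrho hx]]] := dens (r k).
pose B := kball x rho; pose A' := A `&` B; pose j0 : 'I_n := Ordinal hn.
have mA' : leb_measurable A'.
  by apply: (caratheodory_measurable_setI (mu := @leb_outer R n)) => //; exact: leb_measurable_kball.
have fB s : (leb_outer (kball x s) < +oo)%E by exact: leb_outer_kball_fin.
have fA' : (leb_outer A' < +oo)%E.
  by apply: le_lt_trans (fB rho); apply: le_leb_outer; exact: subIsetr.
have v0 : 0 < vol A' by apply: le_lt_trans hx; rewrite mulr_ge0 ?vol_ge0// ltW.
have rho0 : 0 < rho by exact: lt_trans (rpos k) rrho.
apply: (sparse r (r k) (fun a b => corr j0 A' a b / vol A')) => //.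
- exact: corr_correlation.
- move=> j a b jk hab; rewrite /corr (_ : _ `&` _ = set0) ?vol_set0 ?mul0r//.
  apply/seteqP; split => // p [[Ap _] [Apg _]].
  (* A common point [p] would give two points of [A], namely [p] and its right translate, whose
     distance is the norm of the planar point, that is the excluded radius [r j]. *)
  apply: (rbad j _ _ Apg Ap); rewrite /dK hmulK /koranyi planar_norm hab.
  rewrite (_ : r j ^+ 4 = r j ^+ 2 ^+ 2); last by rewrite -exprM.
  by rewrite !sqrtr_sqr ger0_norm ?sqr_ge0// sqrtr_sqr gtr0_norm.
move=> I a b hab.
have sub i : pshift j0 A' (a i) (b i) `<=` kball x (3 * rho).
  move=> p [_ pB]; rewrite /kball /=.
  rewrite -[p](planarK j0 (a i) (b i)) -hmulA; apply: koranyi_hmul_lt pB _.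
  rewrite planar_norm (_ : (- a i) ^+ 4 = a i ^+ 4); last by ring.
  by rewrite sqrrN (le_trans (hab i))// lerXn2r ?nnegrE// ltW.
have := corr_sum_ge mA' fA' (fB _) sub; have := vol_kball3 x rho.
rewrite -/Q -/B => hE hsum.
have -> : \sum_i \sum_j corr j0 A' (a j - a i) (b j - b i) / vol A' =
    (\sum_i \sum_j corr j0 A' (a j - a i) (b j - b i)) / vol A'.
  by rewrite mulr_suml; apply: eq_bigr => i _; rewrite mulr_suml.
set S := \sum_i _ in hsum *.
have S0 : 0 <= S by apply: sumr_ge0 => i _; apply: sumr_ge0 => j _; exact: corr_ge0.
(* Three bounds are chained: [corr_sum_ge] on the ball of radius [3 * rho], the comparison of that
   ball with [B] by the factor [Q], and the density of [A] in [B]. *)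
rewrite ler_pdivlMr// -(ler_pM2r v0) -(ler_pM2r Q0).
have h1 : vol (kball x (3 * rho)) * S <= Q * vol B * S by rewrite ler_wpM2r.
have h2 : d0 * (vol B * S) <= vol A' * S by rewrite mulrA ler_wpM2r// ltW.
have -> : d0 / Q * #|I|%:R ^+ 2 * vol A' * vol A' * Q = d0 * (#|I|%:R ^+ 2 * vol A' ^+ 2).
  by field; rewrite gt_eqF.
apply: (@le_trans _ _ (d0 * (Q * vol B * S))).
  by rewrite ler_pM2l// (le_trans hsum).
have := ler_wpM2l (ltW Q0) h2; lra.
Qed.
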